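(* For every rational number $d > 2$, there is a transient planar graph with uniform polynomial growth of degree $d$.
   Context: Graphs are connected, undirected and equipped with the path metric $d_G$; $B_G(v,r)=\{u\in V(G): d_G(u,v)\le r\}$. A graph $G$ has uniform polynomial growth of degree $d$ if there are constants $C,c>0$ such that $c\,r^d\le |B_G(v,r)|\le C\,r^d$ for all $v\in V(G)$ and all $r\ge 1$. A graph is transient if the simple random walk on it is transient. *)

(* Defs.v *)
From HB Require Import structures.
From mathcomp Require Import all_boot all_order all_algebra.
From mathcomp Require Import finmap.
From mathcomp Require Import all_classical all_reals all_analysis.

Set Implicit Arguments.
Unset Strict Implicit.
Unset Printing Implicit Defensive.

Import Order.TTheory GRing.Theory Num.Theory.
Import numFieldNormedType.Exports.

Local Open Scope classical_set_scope.
Local Open Scope ring_scope.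

(* Nonempty connected simple undirected graphs, possibly infinite. Nonemptiness
   is not automatic: the empty graph would satisfy the growth condition and
   transience vacuously. *)
Record connected_graph := ConnectedGraph {
  vertex :> choiceType;
  adj : rel vertex;
  adj_sym : symmetric adj;
  adj_irrefl : irreflexive adj;
  vertex_inhabited : inhabited vertex;
  adj_connected :
    forall u v, exists2 p : seq vertex, path adj u p & last u p = v }.

Definition walk_of_length (G : connected_graph) (u v : G) (n : nat) : Prop :=
  exists p : seq G, [/\ path (@adj G) u p, last u p = v & size p = n].

Lemma walk_of_length_ex (G : connected_graph) (u v : G) :
  exists n, `[< walk_of_length u v n >].
Proof.
have [p up pv] := adj_connected u v.
by exists (size p); apply/asboolP; exists p.
Qed.

Definition gdist (G : connected_graph) (u v : G) : nat :=
  ex_minn (walk_of_length_ex u v).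

Definition gball (R : realType) (G : connected_graph) (v : G) (r : R) : set G :=
  [set u | (gdist u v)%:R <= r].

(* The cardinal of [fset_set A] is the one of [A] only for a finite set [A]
   (it is 0 otherwise), whence the explicit finiteness requirement. *)
Definition uniform_polynomial_growth (R : realType) (G : connected_graph)
    (d : R) : Prop :=
  exists C c : R, [/\ 0 < C, 0 < c &
    forall (v : G) (r : R), 1 <= r ->
      finite_set (gball v r) /\
      c * r `^ d <= #|` fset_set (gball v r)|%:R <= C * r `^ d].

(* [pos] places the vertices in the plane and [arc u v], restricted to [0, 1],
   is a simple arc drawing the edge {u, v}; its values when [u] and [v] are not
   adjacent are irrelevant. *)
Definition plane_drawing (R : realType) (G : connected_graph)
    (pos : G -> R * R) (arc : G -> G -> R -> R * R) : Prop :=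
  [/\ injective pos,
      forall u v, adj u v ->
        [/\ {within `[0, 1], continuous (arc u v)},
            {in `[0, 1] &, injective (arc u v)},
            arc u v 0 = pos u /\ arc u v 1 = pos v &
            {in `[0, 1], forall t, arc v u t = arc u v (1 - t)}],
      forall u v w, adj u v -> {in `]0, 1[, forall t, arc u v t <> pos w} &
      forall u v u' v', adj u v -> adj u' v' ->
        [set u; v] <> [set u'; v'] ->
        {in `]0, 1[ &, forall s t, arc u v s <> arc u' v' t}].

Definition planar (R : realType) (G : connected_graph) : Prop :=
  exists (pos : G -> R * R) (arc : G -> G -> R -> R * R),
    plane_drawing pos arc.

(* Meant for locally finite graphs only: the value is 0 at a vertex of infinite
   degree. *)
Definition degree (G : connected_graph) (u : G) : nat :=
  #|` fset_set [set v | adj u v]|.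

Definition srw_step (R : realType) (G : connected_graph) (u v : G) : R :=
  if adj u v then (degree u)%:R^-1 else 0.

(* [X] is a simple random walk on [G] started at [v]: it starts at [v] almost
   surely and, conditionally on its first n + 1 positions, the next one is
   uniform among the neighbours of the current one. The Markov property is in
   product form, which also covers conditioning events of probability 0. *)
Definition simple_random_walk (R : realType) (G : connected_graph) (v : G)
    (disp : measure_display) (T : measurableType disp) (P : probability T R)
    (X : nat -> T -> G) : Prop :=
  [/\ forall n (x : G), measurable [set w | X n w = x],
      P [set w | X 0%N w = v] = 1%E &
      forall n (x : nat -> G),
        P [set w | forall i, (i <= n.+1)%N -> X i w = x i] =
        (P [set w | forall i, (i <= n)%N -> X i w = x i] *
         (srw_step R (x n) (x n.+1))%:E)%E].

(* On a locally finite graph with no isolated vertex a simple random walk exists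
   from every vertex, and its law is determined by the conditions above: the
   return probability is the same for all the realizations quantified over. *)
Definition transient (R : realType) (G : connected_graph) : Prop :=
  forall (v : G) (disp : measure_display) (T : measurableType disp)
    (P : probability T R) (X : nat -> T -> G),
  simple_random_walk v P X ->
  (P [set w | exists2 n, (0 < n)%N & X n w = v] < 1)%E.

(* Main.v *)
Require Import Defs.
From HB Require Import structures.
From mathcomp Require Import all_boot all_order all_algebra.
From mathcomp Require Import finmap.
From mathcomp Require Import all_classical all_reals all_analysis.
From mathcomp Require Import zify ring lra.
Import Order.TTheory GRing.Theory Num.Theory.
Import numFieldNormedType.Exports.

Set Implicit Arguments.
Unset Strict Implicit.
Unset Printing Implicit Defensive.

Local Open Scope classical_set_scope.
Local Open Scope nat_scope.

(** The graph is the contact graph of a tiling. Column [t] (for [t = 0, 1, 2],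
    and so on) is a stack of [N t] tiles of height [1 / N t] over the unit
    interval of heights, and two tiles are adjacent when they are consecutive
    in a column or lie in consecutive columns and their height ranges overlap.
    For every positive [N] with [N 0 = 1] this graph is planar: place the
    [j]-th tile of column [t] at the point [(t, j)] and draw straight edges;
    between two consecutive columns the overlap relation is monotone, so that
    no two edges cross ([planar_column_graph]).

    The graph is transient as soon as the series of the [1 / N t] converges
    ([column_graph_transient]). The flow that spreads the unit mass uniformly
    over heights and moves it horizontally has energy at most [1 / N t]
    between the columns [t] and [t.+1]. In dual form, the square of the
    difference between the averages of a function [f] over two consecutive
    columns is at most [1 / N t] times the energy of [f] between these
    columns, so a finitely supported [f] satisfies [f o ^+ 2 <= E * energy f]
    at the root [o]. Such an inequality forbids recurrence: apply it to the
    probability [hit k x] to reach the starting point [v] from [x] in at most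
    [k] steps. This function is finitely supported, equal to 1 at [v] and
    subharmonic elsewhere since it increases with [k], so its energy is at
    most twice the degree of [v] times the probability of escaping from [v]
    for [k.+1] steps. That probability is therefore bounded below uniformly in
    [k] ([return_prob_bound]).

    The growth comes from the choice of [N]. Writing [t] in base [b], let
    [N t] be the product, over the digits of [t] other than the leading one,
    of [b] or, when the digit is 1, of [b * m]. A column [s > 0] seen [b ^ n]
    times finer becomes the block of columns [s * b ^ n + e] with [e < b ^ n],
    and each of its tiles is cut into [M ^ n] tiles with
    [M = b * (b - 1 + m)]. Such a supertile has diameter at most [3 * b ^ n],
    because its leftmost column has [b ^ n] tiles; hence balls of radius
    [4 * b ^ n] have at least [M ^ n] elements ([ball_lower]). Conversely the
    tiles of the block have height at most [1 / (N s * b ^ n)] and [N] varies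
    by bounded factors between neighbouring columns, so fewer than [b ^ n]
    steps do not leave a bounded number of supertiles ([ball_upper]). The
    degree of growth is thus the [d] with [b ^ d = M]. The series of the
    [1 / N t] converges when [m > 1], since passing from one scale to the next
    multiplies its blocks by [(b - 1 + 1 / m) / b < 1]. For [d = p / q > 2]
    the values [b = 4 ^ q] and [m = 4 ^ (p - q) - 4 ^ q + 1] give [M = 4 ^ p]
    and [m > 1]. *)

(** * Walks and graph distance *)

Definition walk (T : Type) (e : rel T) (n : nat) (u v : T) : Prop :=
  exists p, [/\ path e u p, last u p = v & size p = n].

Section Walks.
Variables (T : Type) (e : rel T).

Lemma walk0 u : walk e 0 u u. Proof. by exists [::]. Qed.

Lemma walk1 u v : e u v -> walk e 1 u v.
Proof. by move=> uv; exists [:: v]; rewrite /= uv. Qed.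

Lemma walk_cat n k u v w : walk e n u v -> walk e k v w -> walk e (n + k) u w.
Proof.
move=> [p [up pv <-]] [q [vq qw <-]]; exists (p ++ q).
by rewrite cat_path last_cat size_cat up pv.
Qed.

Lemma walk_sym n u v : symmetric e -> walk e n u v -> walk e n v u.
Proof.
move=> e_sym [p [up pv <-]]; exists (rev (belast u p)); split.
- by rewrite -pv rev_path (eq_path (e' := e)) // => x y; rewrite e_sym.
- by case: p up pv => [|x p] /= _ => [->|_]; rewrite ?rev_cons ?last_rcons.
- by rewrite size_rev size_belast.
Qed.

End Walks.

Section Distance.
Variable G : connected_graph.

Lemma walk_gdist (u v : G) : walk (@adj G) (gdist u v) u v.
Proof. by rewrite /gdist; case: ex_minnP => n /asboolP. Qed.

Lemma gdist_le (u v : G) n : walk (@adj G) n u v -> gdist u v <= n.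
Proof. by move=> w; rewrite /gdist; case: ex_minnP => k _; apply; apply/asboolP. Qed.

Lemma gdist_triangle (u v w : G) : gdist u w <= gdist u v + gdist v w.
Proof. by apply: gdist_le; apply: walk_cat; exact: walk_gdist. Qed.

Lemma gdist_sym (u v : G) : gdist u v = gdist v u.
Proof.
by apply/eqP; rewrite eqn_leq !gdist_le //; apply: walk_sym; try exact: adj_sym;
  exact: walk_gdist.
Qed.

End Distance.

(** * Tilings by columns *)

Section ColumnGraph.
Variable N : nat -> nat.

Definition tile := {x : nat * nat | x.2 < N x.1}.

HB.instance Definition _ := Choice.on tile.

(** The height ranges of [x] and [y], from [x.2 / N x.1] to [x.2.+1 / N x.1]
    and likewise for [y], meet in more than one point; denominators are
    cleared. *)
Definition tiles_overlap (x y : nat * nat) : bool :=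
  (x.2 * N y.1 < y.2.+1 * N x.1) && (y.2 * N x.1 < x.2.+1 * N y.1).

(** One orientation of each edge: upwards or to the right. *)
Definition next_tile (x y : nat * nat) : bool :=
  [|| (x.1 == y.1) && (x.2.+1 == y.2) | (x.1.+1 == y.1) && tiles_overlap x y].

Definition tile_adj (u v : tile) : bool :=
  next_tile (val u) (val v) || next_tile (val v) (val u).

Lemma tile_adj_sym : symmetric tile_adj.
Proof. by move=> u v; rewrite /tile_adj orbC. Qed.

Lemma next_tile_irrefl : irreflexive next_tile.
Proof. by move=> x; rewrite /next_tile; do 2 case: eqP; lia. Qed.

Lemma tile_adj_irrefl : irreflexive tile_adj.
Proof. by move=> u; rewrite /tile_adj next_tile_irrefl. Qed.

Lemma vertical_walk (u v : tile) t j k :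
  val u = (t, j) -> val v = (t, j + k) -> walk tile_adj k u v.
Proof.
elim: k v => [|k IH] v eu ev.
  have -> : v = u by apply: val_inj; rewrite eu ev addn0.
  exact: walk0.
have h : j + k < N t.
  by have := valP v; rewrite ev /= addnS; exact: ltnW.
rewrite -addn1; apply: (walk_cat (IH (exist _ (t, j + k) h) eu erefl)).
apply: walk1.
by rewrite /tile_adj ev /next_tile /= eqxx addnS eqxx.
Qed.

Hypothesis N_gt0 : forall t, 0 < N t.

Lemma height_in_column a c t : a < c -> a * N t %/ c < N t.
Proof.
by move=> ac; rewrite ltn_divLR ?(leq_ltn_trans _ ac) // mulnC ltn_pmul2l.
Qed.

(** The tiles that contain the height [a / c] form a horizontal walk: in
    consecutive columns they share that height, so they overlap. *)
Lemma horizontal_walk (u v : tile) a c t k : a < c ->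
  val u = (t, a * N t %/ c) -> val v = (t + k, a * N (t + k) %/ c) ->
  walk tile_adj k u v.
Proof.
move=> ac; have c0 : 0 < c by exact: leq_ltn_trans ac.
elim: k v => [|k IH] v eu ev.
  have -> : v = u by apply: val_inj; rewrite eu ev addn0.
  exact: walk0.
rewrite -addn1; apply: (walk_cat
  (IH (exist _ (t + k, _) (height_in_column (t + k) ac)) eu erefl)).
apply: walk1.
rewrite /tile_adj ev /next_tile /tiles_overlap /= addnS eqxx /=.
set s := t + k; apply/orP; left; apply/orP; right.
have hs r : a * N r < (a * N r %/ c).+1 * c by rewrite ltn_ceil.
apply/andP; split; rewrite -(ltn_pmul2r c0).
  apply: (@leq_ltn_trans (a * N s * N s.+1)).
    by rewrite mulnAC leq_mul // leq_trunc_div.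
  by rewrite mulnAC [X in _ < X]mulnAC ltn_pmul2r.
apply: (@leq_ltn_trans (a * N s.+1 * N s)).
  by rewrite mulnAC leq_mul // leq_trunc_div.
by rewrite mulnAC [X in _ < X]mulnAC ltn_pmul2r.
Qed.

Lemma val_tileE (u : tile) :
  val u = ((val u).1, (val u).2 * N (val u).1 %/ N (val u).1).
Proof. by rewrite mulnK //; case: (val u). Qed.

Hypothesis N_0 : N 0 = 1.

Definition root_tile : tile.
Proof. by exists (0, 0); rewrite /= N_0. Defined.

Lemma walk_from_root (u : tile) : walk tile_adj (val u).1 root_tile u.
Proof.
apply: (@horizontal_walk _ _ (val u).2 (N (val u).1) 0); first exact: (valP u).
  by rewrite N_0 muln1 divn_small // (valP u).
by rewrite add0n -val_tileE.
Qed.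

Lemma tile_adj_connected u v : exists2 p, path tile_adj u p & last u p = v.
Proof.
have [p [up pv _]] := walk_cat
  (walk_sym tile_adj_sym (walk_from_root u)) (walk_from_root v).
by exists p.
Qed.

Definition column_graph := ConnectedGraph tile_adj_sym tile_adj_irrefl
  (inhabits root_tile) tile_adj_connected.

(** * Planarity *)

Section Planarity.
Variable R : realType.
Local Open Scope ring_scope.

Definition tile_pos (u : tile) : R * R := ((val u).1%:R, (val u).2%:R).

Definition segment (u v : tile) (s : R) : R * R :=
  (((val u).1%:R * (1 - s) + (val v).1%:R * s),
   ((val u).2%:R * (1 - s) + (val v).2%:R * s)).

Lemma segmentC u v s : segment v u s = segment u v (1 - s).
Proof. by rewrite /segment; congr (_, _); ring. Qed.

Lemma continuous_segment u v : continuous (segment u v).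
Proof.
have h (x y : R) : continuous (fun s : R => x * (1 - s) + y * s).
  move=> s; apply: (@continuousD R R^o R (fun s => x * (1 - s)) (fun s => y * s)).
    apply: (@continuousM R R (fun=> x) (fun s => 1 - s)).
      exact: cst_continuous.
    apply: (@continuousB R R^o R (fun=> 1) id); last by [].
    exact: cst_continuous.
  apply: (@continuousM R R (fun=> y) id); first exact: cst_continuous.
  by [].
by move=> s; exact: (cvg_pair (h _ _ s) (h _ _ s)).
Qed.

(** Uniqueness of the integral and fractional parts; it tells apart the
    vertical edges, whose first coordinate is integral, from the horizontal
    ones. *)
Lemma natr_eq_frac (i j : nat) (s s' : R) : 0 <= s < 1 -> 0 <= s' < 1 ->
  i%:R + s = j%:R + s' -> i = j /\ s = s'.
Proof.
move=> /andP[s0 s1] /andP[s0' s1'] e.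
suff ij : i = j by split => //; move: e; rewrite ij => /addrI.
have : (i < j.+1)%N by rewrite -(ltr_nat R) -natr1; lra.
have : (j < i.+1)%N by rewrite -(ltr_nat R) -natr1; lra.
by lia.
Qed.

Lemma segment_pos (u v : tile) s :
  next_tile (val u) (val v) -> 0 < s -> s < 1 -> forall w, segment u v s <> tile_pos w.
Proof.
move=> uv s0 s1 w [e1 e2]; case/orP: uv => /andP[/eqP e /=].
  move=> /eqP e'; move: e2; rewrite -e' -natr1 => e2.
  by have [|||_ ?] := @natr_eq_frac (val u).2 (val w).2 s 0; lra.
move: e1; rewrite -e -natr1 => e1 _.
by have [|||_ ?] := @natr_eq_frac (val u).1 (val w).1 s 0; lra.
Qed.

(** Both columns are ordered by height, so of two tiles on the left the higher
    one meets no tile below those met by the lower one. This is what keeps the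
    edges between two consecutive columns from crossing. *)
Lemma overlap_monotone (j j' i i' t : nat) :
  tiles_overlap (t, j) (t.+1, i) -> tiles_overlap (t, j') (t.+1, i') ->
  (j < j')%N -> (i <= i')%N.
Proof.
rewrite /tiles_overlap /= => /andP[_ h1] /andP[h2 _] jj'.
rewrite -ltnS -(ltn_pmul2r (N_gt0 t)) (leq_trans h1) // (leq_trans _ (ltnW h2)) //.
by rewrite leq_mul.
Qed.

(** Two edges between the same columns that pass through a common point do so
    at the same abscissa, hence at the same parameter; there the ordinate is a
    convex combination of endpoints that are ordered in the same way on both
    sides, so it determines the edge. *)
Lemma segment_inj (u v u' v' : tile) s s' :
  next_tile (val u) (val v) -> next_tile (val u') (val v') ->
  0 < s -> s < 1 -> 0 < s' -> s' < 1 ->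
  segment u v s = segment u' v' s' -> u = u' /\ v = v'.
Proof.
move=> uv uv' s0 s1 s0' s1' [].
suff : (val u).1%:R * (1 - s) + (val v).1%:R * s =
   (val u').1%:R * (1 - s') + (val v').1%:R * s' :> R ->
  (val u).2%:R * (1 - s) + (val v).2%:R * s =
   (val u').2%:R * (1 - s') + (val v').2%:R * s' :> R ->
  val u = val u' /\ val v = val v'.
  by move=> h e1 e2; have [/val_inj-> /val_inj->] := h e1 e2.
move: (val u) (val v) (val u') (val v') uv uv' => [t j] [r i] [t' j'] [r' i'].
case/orP => /= /andP[/eqP <-]; last move=> ov.
  move=> /eqP <-; case/orP => /= /andP[/eqP <-].
    move=> /eqP <- e1 e2.
    have tt : t = t' by apply/eqP; rewrite -(eqr_nat R); apply/eqP; lra.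
    have [|||jj _] := @natr_eq_frac j j' s s'; [lra|lra| |by rewrite tt jj].
    by move: e2; rewrite -!natr1; lra.
  move=> _ e1 _; have [|||_ ?] := @natr_eq_frac t t' 0 s'; [lra|lra| |exfalso; lra].
  by move: e1; rewrite -natr1; lra.
case/orP => /= /andP[/eqP <-]; last move=> ov'.
  move=> _ e1 _; have [|||_ ?] := @natr_eq_frac t t' s 0; [lra|lra| |exfalso; lra].
  by move: e1; rewrite -natr1; lra.
move=> e1 e2; have [|||tt ss] := @natr_eq_frac t t' s s'; [lra|lra| |].
  by move: e1; rewrite -!natr1; lra.
subst t' s'.
have [jj|jj|jj] := ltngtP j j'.
- have ii := overlap_monotone ov ov' jj.
  have jjR : j%:R + 1 <= j'%:R :> R by rewrite natr1 ler_nat.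
  have iiR : i%:R <= i'%:R :> R by rewrite ler_nat.
  by exfalso; nra.
- have ii := overlap_monotone ov' ov jj.
  have jjR : j'%:R + 1 <= j%:R :> R by rewrite natr1 ler_nat.
  have iiR : i'%:R <= i%:R :> R by rewrite ler_nat.
  by exfalso; nra.
- subst j'; split=> //; congr (_, _).
  apply/eqP; rewrite -(eqr_nat R); apply/eqP.
  by apply: (mulIf (lt0r_neq0 s0)); lra.
Qed.

Lemma adj_next (u v : tile) : tile_adj u v ->
  exists u' v' , [/\ next_tile (val u') (val v'),
    ([set u; v] = [set u'; v'])%classic &
    forall s : R, 0 < s -> s < 1 ->
      exists s', [/\ 0 < s', s' < 1 & segment u v s = segment u' v' s']].
Proof.
case/orP => uv; first by exists u, v; split=> // s ? ?; exists s.
exists v, u; split=> //; first exact: setUC.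
by move=> s s0 s1; exists (1 - s); rewrite segmentC; split => //; lra.
Qed.

Lemma planar_column_graph : planar R column_graph.
Proof.
exists tile_pos, segment; split.
- move=> u v [] /eqP; rewrite eqr_nat => /eqP e1 /eqP; rewrite eqr_nat => /eqP e2.
  by apply: val_inj; rewrite [LHS]surjective_pairing e1 e2 -surjective_pairing.
- move=> u v uv; split.
  + by apply: continuous_subspaceT => s; exact: continuous_segment.
  + move=> s s' _ _ [] e1 e2.
    have : ((val u).1 != (val v).1) || ((val u).2 != (val v).2).
      rewrite -negb_and; apply/negP => /andP[/eqP e3 /eqP e4].
      have := tile_adj_irrefl u; rewrite {2}(_ : u = v) ?[tile_adj u v]uv //.
      by apply: val_inj; rewrite [LHS]surjective_pairing e3 e4 -surjective_pairing.
    case/orP; rewrite -(eqr_nat R) -subr_eq0 => /mulfI; apply; lra.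
  + by split; rewrite /segment /tile_pos; congr (_, _); ring.
  + by move=> s _; exact: segmentC.
- move=> u v w /adj_next[u' [v' [uv' _ h]]] s.
  rewrite in_itv /= => /andP[s0 s1]; have [s' [s0' s1' ->]] := h s s0 s1.
  exact: segment_pos.
- move=> u v u1 v1 /adj_next[u' [v' [uv' -> h]]] /adj_next[u1' [v1' [uv1' -> h1]]].
  move=> neq s s2; rewrite !in_itv /= => /andP[s0 s1] /andP[s20 s21].
  have [s' [s0' s1' ->]] := h s s0 s1.
  have [s2' [s20' s21' ->]] := h1 s2 s20 s21.
  by move=> /(segment_inj uv' uv1' s0' s1' s20' s21')[e e']; apply: neq; rewrite e e'.
Qed.

End Planarity.
End ColumnGraph.

(** * A criterion for transience *)

Local Open Scope ring_scope.

Lemma ler_sum_subseq (R : numDomainType) (T : eqType) (s s' : seq T) (F : T -> R) :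
  (forall x, 0 <= F x) -> uniq s -> {subset s <= s'} ->
  \sum_(x <- s) F x <= \sum_(x <- s') F x.
Proof.
move=> F0; elim: s s' => [|x s IH] s' /=.
  by move=> _ _; rewrite big_nil sumr_ge0.
move=> /andP[xs us] ss'; have xs' : x \in s' by rewrite ss' ?mem_head.
rewrite big_cons [leRHS](big_rem x) //= lerD2l; apply: IH => // y ys.
rewrite rem_mem ?ss' ?in_cons ?ys ?orbT //.
by apply: contraNneq xs => <-.
Qed.

Section Transience.
Variables (R : realType) (G : connected_graph).

Definition neighbours (u : G) : {fset G} := fset_set [set v | adj u v].

Hypothesis locally_finite : forall u : G, finite_set [set v | adj u v].

Lemma in_neighbours u v : (v \in neighbours u) = adj u v.
Proof. by rewrite in_fset_set //; apply/idP/idP => [/set_mem|/mem_set]. Qed.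

Hypothesis no_isolated : forall u : G, exists v, adj u v.

Lemma degree_gt0 (u : G) : 0 < (degree u)%:R :> R.
Proof.
have [v uv] := no_isolated u; rewrite ltr0n cardfs_gt0; apply/fset0Pn.
by exists v; rewrite in_neighbours.
Qed.

Lemma sum_neighbours_const (u : G) (a : R) :
  \sum_(y <- neighbours u) a = (degree u)%:R * a.
Proof.
by rewrite big_const_seq count_predT iter_addr addr0 mulr_natl.
Qed.

Section Hitting.
Variable v : G.

(** The probability to visit [v] at some time in [0 .. k], starting from [x];
    it is defined by its one-step recursion rather than from a random walk, so as
    to be a plain function on the graph. *)
Fixpoint hit (k : nat) (x : G) : R :=
  if k is k'.+1 then
    if x == v then 1 else \sum_(y <- neighbours x) (degree x)%:R^-1 * hit k' y
  else (x == v)%:R.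

(** The probability to visit [v] at some time in [1 .. k.+1], starting from
    [x]. *)
Definition return_prob (k : nat) (x : G) : R :=
  \sum_(y <- neighbours x) (degree x)%:R^-1 * hit k y.

Lemma hitS k x : hit k.+1 x = if x == v then 1 else return_prob k x.
Proof. by []. Qed.

Lemma hit_self k : hit k v = 1.
Proof. by case: k => [|k] /=; rewrite eqxx. Qed.

Lemma hit_ge0 k x : 0 <= hit k x.
Proof.
elim: k x => [|k IH] x //=; case: ifP => // _.
by apply: sumr_ge0 => y _; rewrite mulr_ge0 // invr_ge0.
Qed.

Lemma hit_nondecreasing k x : hit k x <= hit k.+1 x.
Proof.
elim: k x => [|k IH] x.
  rewrite hitS /=; case: eqP => // _; apply: sumr_ge0 => y _.
  by rewrite mulr_ge0 ?invr_ge0.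
rewrite hitS [leRHS]hitS; case: ifP => // _; apply: ler_sum => y _.
by rewrite ler_wpM2l // invr_ge0.
Qed.

(** The ball of radius [k] around [v], with repetitions. *)
Fixpoint hit_support (k : nat) : seq G :=
  if k is k'.+1 then
    hit_support k' ++ flatten [seq (neighbours x : seq G) | x <- hit_support k']
  else [:: v].

Lemma hit_supportS k x y : x \in hit_support k -> adj x y ->
  y \in hit_support k.+1.
Proof.
move=> xk xy /=; rewrite mem_cat; apply/orP; right.
apply/flattenP; exists (neighbours x : seq G); last by rewrite in_neighbours.
by apply/mapP; exists x.
Qed.

Lemma hit_supportP k x : hit k x != 0 -> x \in hit_support k.
Proof.
elim: k x => [|k IH] x /=.
  by rewrite pnatr_eq0 eqb0 negbK inE.
case: (x =P v) => [->|_ h].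
  by move=> _; rewrite mem_cat IH // hit_self oner_eq0.
have [y [xy hy]] : exists y, adj x y /\ hit k y != 0.
  apply/not_existsP => nex; case/eqP: h; rewrite big_seq big1 // => y.
  rewrite in_neighbours => xy; have := nex y.
  by case: eqP => [->|_ /not_andP[]//]; rewrite mulr0.
by apply: (hit_supportS (IH _ hy)); rewrite adj_sym.
Qed.

End Hitting.

(** The edges with both ends in [S] are counted twice. *)
Definition energy (S : seq G) (f : G -> R) : R :=
  \sum_(x <- S) \sum_(y <- S | adj x y) (f x - f y) ^+ 2.

(** The neighbours of the support are required to be in [S] as well, so that
    [energy S f] sees every edge along which [f] varies. *)
Definition supported_inside (S : seq G) (f : G -> R) : Prop :=
  forall x, f x != 0 -> x \in S /\ forall y, adj x y -> y \in S.

(** This says that the effective resistance from [o] to infinity is finite,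
    through Thomson's principle and without mentioning flows. *)
Definition point_energy_bound (o : G) : Prop :=
  exists E : R, forall (f : G -> R) (S : seq G), uniq S ->
    supported_inside S f -> f o ^+ 2 <= E * energy S f.

Lemma energy_ge0 S f : 0 <= energy S f.
Proof. by apply: sumr_ge0 => x _; apply: sumr_ge0 => y _; rewrite sqr_ge0. Qed.

Lemma energy_edge S f x y : x \in S -> y \in S -> adj x y ->
  (f x - f y) ^+ 2 <= energy S f.
Proof.
move=> xS yS xy; rewrite /energy (big_rem x) //= (big_rem y) //= xy -addrA.
rewrite lerDl addr_ge0 ?sumr_ge0 // => [z _|z _]; first exact: sqr_ge0.
by apply: sumr_ge0 => w _; exact: sqr_ge0.
Qed.

(** The value at [y] differs from the value at [x] by the variation along one
    edge, which is a term of the energy. *)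
Lemma point_energy_bound_adj x y : adj x y ->
  point_energy_bound x -> point_energy_bound y.
Proof.
move=> xy [E bndE]; exists (2 * E + 2) => f S uS suppf.
have := bndE f S uS suppf.
suff : (f x - f y) ^+ 2 <= energy S f.
  by move: (sqr_ge0 (2 * f x - f y)); nra.
have [->|neq] := eqVneq (f x) (f y).
  by rewrite subrr expr0n energy_ge0.
have [xS yS] : x \in S /\ y \in S.
  have [fx0|/suppf[xS]] := eqVneq (f x) 0; last by move=> /(_ _ xy).
  have /suppf[yS] : f y != 0 by rewrite -fx0 eq_sym.
  by rewrite adj_sym in xy => /(_ _ xy).
exact: energy_edge.
Qed.

Lemma point_energy_bound_all o v : point_energy_bound o -> point_energy_bound v.
Proof.
have [p op <-] := adj_connected o v.
elim: p o op => [|x p IH] o //= /andP[ox xp] bo.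
by apply: (IH _ xp); exact: point_energy_bound_adj ox bo.
Qed.

(** Summation by parts: exchanging the ends of the edges turns the second half
    of [(f x - f y) ^+ 2 = f x * (f x - f y) + f y * (f y - f x)] into the
    first. *)
Lemma energy_laplacian S f : uniq S -> supported_inside S f ->
  energy S f =
  2 * \sum_(x <- S) f x * \sum_(y <- neighbours x) (f x - f y).
Proof.
move=> uS suppf.
have sumE x : f x * \sum_(y <- neighbours x) (f x - f y) =
    \sum_(y <- S | adj x y) f x * (f x - f y).
  have [->|fx0] := eqVneq (f x) 0.
    by rewrite mul0r big1 // => y _; rewrite mul0r.
  have [_ nS] := suppf x fx0.
  rewrite mulr_sumr -[RHS]big_filter; apply: perm_big.
  apply: uniq_perm; rewrite ?fset_uniq ?filter_uniq // => y.
  by rewrite mem_filter in_neighbours; case xy: (adj x y) => /=; rewrite ?nS.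
rewrite (eq_bigr _ (fun x _ => sumE x)) mulrDl mul1r {1}/energy.
have swap : \sum_(x <- S) \sum_(y <- S | adj x y) f x * (f x - f y) =
    \sum_(x <- S) \sum_(y <- S | adj x y) f y * (f y - f x).
  rewrite (eq_bigr _ (fun x _ => big_mkcond _ _)) exchange_big /=.
  apply: eq_bigr => y _; rewrite [RHS]big_mkcond; apply: eq_bigr => x _.
  by rewrite adj_sym.
rewrite {2}swap -big_split; apply: eq_bigr => x _.
by rewrite -big_split; apply: eq_bigr => y _ /=; ring.
Qed.

(** Since [hit k <= hit k.+1], and [hit k.+1] is the average of [hit k] over the
    neighbours at every point but [v], only [v] contributes positively to the
    energy of [hit k] written as the sum of [f x] times the Laplacian of [f] at
    [x]; its contribution is [degree v * (1 - return_prob k v)]. As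
    [hit k v = 1], the energy is also bounded below. *)
Lemma return_prob_bound v : point_energy_bound v ->
  exists2 eps : R, 0 < eps & forall k, return_prob v k v <= 1 - eps.
Proof.
move=> [E bndE].
have bnd k : 1 <= E * (2 * ((degree v)%:R * (1 - return_prob v k v))).
  pose S := undup (hit_support v k.+1).
  have uS : uniq S := undup_uniq _.
  have suppf : supported_inside S (hit v k).
    move=> x /hit_supportP xk; split.
      by rewrite mem_undup mem_cat xk.
    by move=> y xy; rewrite mem_undup; exact: hit_supportS xk xy.
  have := bndE _ _ uS suppf; rewrite hit_self expr1n => /le_trans; apply.
  have E0 : 0 <= E.
    have := bndE _ _ uS suppf; rewrite hit_self expr1n => h.
    rewrite leNgt; apply/negP => E0; have := energy_ge0 S (hit v k); nra.
  rewrite ler_wpM2l // energy_laplacian // ler_wpM2l //.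
  have lapE x : \sum_(y <- neighbours x) (hit v k x - hit v k y) =
      (degree x)%:R * (hit v k x - return_prob v k x).
    rewrite sumrB sum_neighbours_const mulrBr; congr (_ - _).
    rewrite mulr_sumr; apply: eq_bigr => y _.
    by rewrite mulrA mulfV ?mul1r // gt_eqF // degree_gt0.
  have vS : v \in S.
    by have [] := suppf v; rewrite ?hit_self ?oner_eq0.
  rewrite (bigD1_seq v) //= lapE hit_self mul1r gerDl.
  apply: sumr_le0 => x xv; rewrite lapE mulr_ge0_le0 ?hit_ge0 //.
  rewrite pmulr_rle0 ?degree_gt0 // subr_le0.
  by apply: le_trans (hit_nondecreasing v k x) _; rewrite hitS (negPf xv).
have E0 : 0 < E.
  rewrite ltNge; apply/negP => E0; have := bnd 0%N.
  have -> : return_prob v 0 v = 0.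
    rewrite /return_prob big_seq big1 // => y; rewrite in_neighbours => vy /=.
    by case: eqP vy => [->|_]; rewrite ?adj_irrefl // mulr0.
  by have := degree_gt0 v; nra.
exists (E * (2 * (degree v)%:R))^-1.
  by rewrite invr_gt0 mulr_gt0 // mulr_gt0 // degree_gt0.
move=> k; have K0 : 0 < E * (2 * (degree v)%:R) :> R.
  by rewrite mulr_gt0 // mulr_gt0 // degree_gt0.
rewrite lerBrDl -lerBrDr -[leLHS]mul1r ler_pdivrMr //.
by apply: le_trans (bnd k) _; rewrite le_eqVlt; apply/orP; left; apply/eqP; ring.
Qed.

Section RandomWalk.
Variables (v : G) (disp : measure_display) (T : measurableType disp).
Variables (P : probability T R) (X : nat -> T -> G).
Hypothesis X_srw : simple_random_walk v P X.

Definition cylinder (n : nat) (x : nat -> G) : set T :=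
  [set w | forall i, (i <= n)%N -> X i w = x i].

Definition avoids (a b : nat) : set T :=
  [set w | forall i, (a <= i < b)%N -> X i w <> v].

Lemma measurable_cylinder n x : measurable (cylinder n x).
Proof.
have -> : cylinder n x =
    \bigcap_(i in [set i | (i <= n)%N]) [set w | X i w = x i] by [].
apply: bigcap_measurable; first by exists 0%N.
by move=> i _; case: X_srw => + _ _; exact.
Qed.

Lemma measurable_avoids a b : measurable (avoids a b).
Proof.
have -> : avoids a b =
    \bigcap_i (if (a <= i < b)%N then ~` [set w | X i w = v] else setT).
  apply/seteqP; split=> w /= h i.
    by move=> _; case: ifP => // ib; exact: h.
  by move=> ib; have := h i I; rewrite ib.
apply: bigcapT_measurable => i; case: ifP => // _.
by apply: measurableC; case: X_srw => + _ _; exact.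
Qed.

Definition extend (n : nat) (x : nat -> G) (y : G) (i : nat) : G :=
  if (i <= n)%N then x i else y.

(** The cylinder splits according to the next position, up to a null set that
    a lower bound can ignore: only finite additivity over the neighbours of the
    current position is used, so the graph need not be countable. *)
Lemma cylinder_branch n x B (g : G -> R) : measurable B ->
  (forall y, (P (cylinder n.+1 (extend n x y)) * (g y)%:E <=
              P (cylinder n.+1 (extend n x y) `&` B))%E) ->
  (P (cylinder n x) *
     (\sum_(y <- neighbours (x n)) (degree (x n))%:R^-1 * g y)%:E <=
   P (cylinder n x `&` B))%E.
Proof.
move=> mB bnd; set F := fun y => cylinder n.+1 (extend n x y) `&` B.
have mF y : measurable (F y).
  by apply: measurableI => //; exact: measurable_cylinder.
have tF : trivIset [set` neighbours (x n)] F.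
  apply/trivIsetP => y z _ _ yz; apply/seteqP; split=> w // [[wy _] [wz _]].
  have := wy n.+1 (leqnn _); rewrite (wz n.+1 (leqnn _)) /extend ltnn => e.
  by rewrite e eqxx in yz.
apply: (@le_trans _ _ (P (\big[setU/set0]_(y <- neighbours (x n)) F y))).
  rewrite measure_fbigsetU //.
  have -> : P (cylinder n x) = (fine (P (cylinder n x)))%:E.
    by rewrite fineK // fin_num_measure //; exact: measurable_cylinder.
  rewrite -EFinM mulr_sumr -sumEFin big_seq [leRHS]big_seq.
  apply: lee_sum => y; rewrite in_neighbours => xy.
  apply: le_trans (bnd y); rewrite /cylinder; case: X_srw => _ _ ->.
  rewrite /srw_step /extend leqnn ltnn xy mulrA !EFinM fineK.
    rewrite le_eqVlt; apply/orP; left; apply/eqP; congr (P _ * _ * _)%E.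
    by apply/seteqP; split=> w h i ik; have := h i ik; rewrite ik.
  by rewrite fin_num_measure //; exact: measurable_cylinder.
apply: le_measure; rewrite ?inE.
- by rewrite -bigcup_fset; apply: fin_bigcup_measurable.
- by apply: measurableI => //; exact: measurable_cylinder.
rewrite -bigcup_fset => w [y _ [h Bw]]; split=> // i ik.
by have := h i (leqW ik); rewrite /extend ik.
Qed.

Lemma sum_neighbours_return (x : G) k :
  \sum_(y <- neighbours x) (degree x)%:R^-1 * (1 - hit v k y) =
  1 - return_prob v k x.
Proof.
under eq_bigr do rewrite mulrBr mulr1.
by rewrite sumrB sum_neighbours_const mulfV // gt_eqF // degree_gt0.
Qed.

(** A walk avoids [v] at least as often as the recursion that defines [hit]
    predicts: each step of the recursion is an instance of [cylinder_branch]. *)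
Lemma avoids_ge k n x :
  (P (cylinder n x) * (1 - hit v k (x n))%:E <=
   P (cylinder n x `&` avoids n (n + k.+1)))%E.
Proof.
elim: k n x => [|k IH] n x.
  rewrite /=; case: eqP => [_|xv].
    by rewrite subrr mule0.
  rewrite subr0 mule1; apply: le_measure; rewrite ?inE.
  - exact: measurable_cylinder.
  - apply: measurableI; [exact: measurable_cylinder|exact: measurable_avoids].
  move=> w cw; split=> // i; rewrite addn1 ltnS -eqn_leq => /eqP <-.
  by rewrite cw.
rewrite hitS; case: eqP => [_|xv]; first by rewrite subrr mule0.
rewrite -sum_neighbours_return.
have -> : cylinder n x `&` avoids n (n + k.+2) =
    cylinder n x `&` avoids n.+1 (n + k.+2).
  apply/seteqP; split=> w [cw h]; split=> // i ik; first by apply: h; lia.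
  have [->|ni] := eqVneq i n; first by rewrite cw.
  by apply: h; lia.
apply: cylinder_branch; first exact: measurable_avoids.
by move=> y; have := IH n.+1 (extend n x y); rewrite /extend ltnn addSnnS.
Qed.

Lemma avoids_start k :
  ((1 - return_prob v k v)%:E <= P (avoids 1 k.+2))%E.
Proof.
have P0 : P (cylinder 0 (fun=> v)) = 1%E.
  case: X_srw => _ <- _; congr (P _); apply/seteqP; split=> w /=; first exact.
  by move=> h i; rewrite leqn0 => /eqP ->.
rewrite -[leLHS]mul1e -P0 -sum_neighbours_return.
apply: (@le_trans _ _ (P (cylinder 0 (fun=> v) `&` avoids 1 k.+2))).
  apply: cylinder_branch; first exact: measurable_avoids.
  by move=> y; have := avoids_ge k 1 (extend 0 (fun=> v) y); rewrite /extend.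
apply: le_measure; rewrite ?inE; last exact: subIsetr.
- apply: measurableI; [exact: measurable_cylinder|exact: measurable_avoids].
- exact: measurable_avoids.
Qed.

End RandomWalk.

(** The return probabilities in bounded time stay away from 1, and the event of
    returning is the increasing union of the bounded-time ones. *)
Lemma transient_of_point_energy_bound o : point_energy_bound o -> transient R G.
Proof.
move=> bo v disp T P X srw.
have [eps eps0 ret] := return_prob_bound (point_energy_bound_all v bo).
have mret k : measurable (~` avoids v X 1 k).
  by apply: measurableC; exact: measurable_avoids srw _ _.
have -> : [set w | exists2 n, (0 < n)%N & X n w = v] =
    \bigcup_k (~` avoids v X 1 k).
  apply/seteqP; split=> w /=.
    by move=> [n n0 Xn]; exists n.+1 => // /(_ n); rewrite n0 ltnSn => /(_ isT).
  move=> [k _ /= /existsNP[n /not_implyP[/andP[n0 _] /contrapT Xn]]].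
  by exists n.
have nd : nondecreasing_seq (fun k => ~` avoids v X 1 k).
  move=> k l kl; rewrite subsetEset => w; apply: contra_not => h i /andP[i0 ik].
  by apply: h; rewrite i0 (leq_trans ik).
have cv := @nondecreasing_cvg_mu _ _ _ P _ mret (bigcupT_measurable _ mret) nd.
apply: (@le_lt_trans _ _ (1 - eps)%:E); last by rewrite lte_fin gtrBl.
rewrite -(cvg_lim _ cv) //; apply: lime_le; first by apply/cvg_ex; eexists; exact: cv.
apply: nearW => k /=.
apply: (@le_trans _ _ (P (~` avoids v X 1 k.+2))).
  apply: le_measure; rewrite ?inE //.
  by apply: subsetPset; apply: nd; rewrite leqW.
rewrite probability_setC; last exact: measurable_avoids srw _ _.
have mk : measurable (avoids v X 1 k.+2) by exact: measurable_avoids srw _ _.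
have := avoids_start srw k; have := ret k.
rewrite -(fineK (fin_num_measure P _ mk)) -EFinB !lee_fin; lra.
Qed.

End Transience.

(** * Energy in a tiling by columns *)

Lemma weighted_cauchy_schwarz (R : realFieldType) (I : Type) (r : seq I) (w z : I -> R) :
  (forall i, 0 <= w i) ->
  (\sum_(i <- r) w i * z i) ^+ 2 <=
  (\sum_(i <- r) w i) * \sum_(i <- r) w i * z i ^+ 2.
Proof.
move=> w0; elim: r => [|i r IH]; first by rewrite !big_nil expr0n mul0r.
rewrite !big_cons.
have A0 : 0 <= \sum_(j <- r) w j by exact: sumr_ge0.
have C0 : 0 <= \sum_(j <- r) w j * z j ^+ 2.
  by apply: sumr_ge0 => j _; rewrite mulr_ge0 // sqr_ge0.
move: (w0 i) IH A0 C0; move: (w i) (z i) (\sum_(j <- r) w j) (\sum_(j <- r) w j * z j)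
  (\sum_(j <- r) w j * z j ^+ 2) => u x A B C u0 BAC A0 C0.
(* As [B ^+ 2 <= A * C], the polynomial [A * x ^+ 2 - 2 * B * x + C] is nonnegative. *)
suff : 2 * B * x <= A * x ^+ 2 + C by nra.
have [A1|A1] := ltP 0 A.
  rewrite -subr_ge0 -(pmulr_rge0 _ A1).
  have -> : A * (A * x ^+ 2 + C - 2 * B * x) =
      (A * x - B) ^+ 2 + (A * C - B ^+ 2) by ring.
  by rewrite addr_ge0 ?sqr_ge0 // subr_ge0.
have A00 : A = 0 by apply/eqP; rewrite eq_le A0 A1.
have B00 : B = 0.
  by apply/eqP; rewrite -sqrf_eq0 eq_le sqr_ge0 andbT (le_trans BAC) // A00 mul0r.
by rewrite A00 B00 mulr0 !mul0r add0r.
Qed.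

Lemma big_nat_shift (T : Type) (idx : T) (op : T -> T -> T) (F : nat -> T) k l :
  \big[op/idx]_(k * l <= j < k.+1 * l) F j = \big[op/idx]_(0 <= i < l) F (k * l + i)%N.
Proof.
rewrite -{1}[(k * l)%N]add0n big_addn mulSn addnK.
by apply: eq_bigr => i _; rewrite addnC.
Qed.

Lemma sum_div_nat (R : pzSemiRingType) (n n' : nat) (p : nat -> R) : (0 < n')%N ->
  \sum_(0 <= l < n * n') p (l %/ n')%N = n'%:R * \sum_(0 <= j < n) p j.
Proof.
move=> n0; rewrite big_nat_mul mulr_sumr; apply: eq_bigr => j _.
rewrite big_nat_shift (eq_big_nat _ _ (F2 := fun=> p j)).
  by rewrite sumr_const_nat subn0 mulr_natl.
by move=> i /andP[_ il]; rewrite divnMDl // divn_small // addn0.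
Qed.

(** Both averages are averages over the [n * n'] intervals of the common
    refinement, [l %/ n'] and [l %/ n] being the tiles that contain the [l]-th
    interval. Cauchy-Schwarz bounds the square of the difference by the mean of
    the squares, and an overlapping pair accounts for at most [n'] intervals. *)
Lemma average_difference (R : realFieldType) (n n' : nat) (p q : nat -> R) :
  (0 < n)%N -> (0 < n')%N ->
  ((\sum_(0 <= j < n) p j) / n%:R - (\sum_(0 <= i < n') q i) / n'%:R) ^+ 2 <=
  (\sum_(0 <= j < n) \sum_(0 <= i < n' | (j * n' < i.+1 * n)%N && (i * n < j.+1 * n')%N)
     (p j - q i) ^+ 2) / n%:R.
Proof.
move=> n0 n0'; have nR : 0 < n%:R :> R by rewrite ltr0n.
have nR' : 0 < n'%:R :> R by rewrite ltr0n.
set L := (n * n')%N; have LE : L%:R = n%:R * n'%:R :> R by rewrite natrM.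
have LR : 0 < L%:R :> R by rewrite LE mulr_gt0.
pose z l := p (l %/ n')%N - q (l %/ n)%N.
have -> : (\sum_(0 <= j < n) p j) / n%:R - (\sum_(0 <= i < n') q i) / n'%:R =
    \sum_(0 <= l < L) L%:R^-1 * z l.
  rewrite -mulr_sumr sumrB sum_div_nat // /L mulnC sum_div_nat // natrM.
  by field; rewrite !gt_eqF.
apply: le_trans (weighted_cauchy_schwarz _ _ _) _; first by rewrite invr_ge0.
rewrite sumr_const_nat subn0 -[_ *+ L]mulr_natl mulfV ?gt_eqF // mul1r -mulr_sumr.
set X := \sum_(0 <= j < n) _; have -> : X / n%:R = L%:R^-1 * (n'%:R * X).
  by rewrite LE; field; rewrite !gt_eqF.
apply: ler_wpM2l; first by rewrite invr_ge0.
rewrite /X mulr_sumr.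
rewrite big_nat_mul; apply: ler_sum_nat => j /andP[_ jn].
set D := \sum_(0 <= i < n' | _) _.
rewrite big_nat_shift; apply: (@le_trans _ _ (\sum_(0 <= i < n') D)); last first.
  by rewrite sumr_const_nat subn0 mulr_natl.
apply: ler_sum_nat => i /andP[_ il].
rewrite /z divnMDl // divn_small // addn0 /D.
set l := (j * n' + i)%N; have lL : (l < n * n')%N.
  by rewrite /l (leq_trans (n := j.+1 * n'))%N ?leq_mul // mulSn addnC ltn_add2r.
have li : (l %/ n < n')%N by rewrite ltn_divLR // mulnC.
have ov : (j * n' < (l %/ n).+1 * n)%N && (l %/ n * n < j.+1 * n')%N.
  have := ltn_ceil l n0; have := leq_trunc_div l n.
  by rewrite {1 4}/l mulSn => h1 h2; apply/andP; split; lia.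
rewrite big_mkcond (bigD1_seq (l %/ n)%N) ?mem_index_iota ?iota_uniq //= ov.
by rewrite lerDl sumr_ge0 // => k _; case: ifP => // _; rewrite sqr_ge0.
Qed.

(** Cauchy-Schwarz with weights [w]: resistances in series add up. *)
Lemma telescoping_energy (R : realFieldType) (T : nat) (w a D : nat -> R) :
  (forall t, 0 < w t) -> (forall t, (a t - a t.+1) ^+ 2 <= w t * D t) ->
  (a 0%N - a T) ^+ 2 <= (\sum_(0 <= t < T) w t) * \sum_(0 <= t < T) D t.
Proof.
move=> w0 step.
have -> : a 0%N - a T = \sum_(0 <= t < T) w t * ((a t - a t.+1) / w t).
  rewrite -opprB -telescope_sumr // -sumrN; apply: eq_bigr => t _.
  by rewrite mulrC divfK ?opprB // gt_eqF.
apply: le_trans (weighted_cauchy_schwarz _ _ _) _ => [t|]; first exact: ltW.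
apply: ler_wpM2l; first by apply: sumr_ge0 => t _; exact: ltW.
apply: ler_sum => t _.
have -> : w t * ((a t - a t.+1) / w t) ^+ 2 = (a t - a t.+1) ^+ 2 / w t.
  by field; rewrite gt_eqF.
by rewrite ler_pdivrMr // mulrC.
Qed.

Section ColumnEnergy.
Variables (R : realType) (N : nat -> nat).
Hypotheses (N_gt0 : forall t, (0 < N t)%N) (N_0 : N 0%N = 1%N).
Let G := column_graph N_gt0 N_0.
Let root : tile N := root_tile N_0.

(** Pairs outside of the tiling are sent to the root. *)
Definition tile_of (x : nat * nat) : tile N := insubd root x.

Lemma val_tile_of x : (x.2 < N x.1)%N -> val (tile_of x) = x.
Proof. by move=> h; rewrite /tile_of val_insubd h. Qed.

Lemma tile_ofK u : tile_of (val u) = u.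
Proof. by rewrite /tile_of valKd. Qed.

Lemma column_graph_locally_finite (u : G) : finite_set [set v | adj u v].
Proof.
set t := (val u).1.
pose s := [seq tile_of x | x <- [seq (r, j) | r <- iota 0 t.+2,
  j <- iota 0 (N t.-1 + N t + N t.+1)]].
apply: (sub_finite_set _ (finite_seq s)) => v /= uv.
apply/mapP; exists (val v); last by rewrite tile_ofK.
apply/allpairsP; exists (val v); rewrite -surjective_pairing !mem_iota /=.
have := valP v; move: uv; rewrite /adj /= /tile_adj /next_tile -/t.
by case/orP => /orP[] /andP[/eqP e _] /= h; split=> //; rewrite ?add0n; move: h;
  rewrite ?e -?e /=; lia.
Qed.

Lemma column_graph_no_isolated (u : G) : exists v : G, adj u v.
Proof.
pose t := (val u).1; pose v := tile_of (t.+1, (val u).2 * N t.+1 %/ N t)%N.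
have vE : val v = (t + 1, (val u).2 * N (t + 1) %/ N t)%N.
  rewrite addn1 /v val_tile_of //=; apply: height_in_column => //; exact: (valP u).
have [p [up _]] := horizontal_walk N_gt0 (valP u) (val_tileE N_gt0 u) vE.
by case: p up => // x p /andP[ux _] _; exists x.
Qed.

Definition column_average (f : G -> R) (t : nat) : R :=
  (\sum_(0 <= j < N t) f (tile_of (t, j))) / (N t)%:R.

Definition column_step_energy (f : G -> R) (t : nat) : R :=
  \sum_(0 <= j < N t) \sum_(0 <= i < N t.+1 | tiles_overlap N (t, j) (t.+1, i))
     (f (tile_of (t, j)) - f (tile_of (t.+1, i))) ^+ 2.

Lemma column_average_step f t :
  (column_average f t - column_average f t.+1) ^+ 2 <=
  (N t)%:R^-1 * column_step_energy f t.
Proof. by rewrite mulrC; exact: average_difference. Qed.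

(** The link between sums indexed by heights and the energy, which is a sum over
    an arbitrary finite set of tiles. *)
Lemma ler_sum_column (f : tile N -> R) (S : seq (tile N)) t : uniq S ->
  (forall u, 0 <= f u) -> (forall u, f u != 0 -> u \in S) ->
  \sum_(0 <= j < N t) f (tile_of (t, j)) <= \sum_(u <- S | (val u).1 == t) f u.
Proof.
move=> uS f0 fS.
rewrite -(big_map (fun j => tile_of (t, j)) predT f) -[leRHS]big_filter.
rewrite (bigID (fun u => f u == 0)) /= big1 ?add0r => [|u /eqP //].
rewrite -big_filter; apply: ler_sum_subseq => //.
  apply: filter_uniq; rewrite map_inj_in_uniq ?iota_uniq // => j i.
  rewrite !mem_index_iota /= => jN iN /(congr1 val).
  by rewrite !val_tile_of // => -[].
move=> u; rewrite !mem_filter => /andP[/fS ->] /mapP[j].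
by rewrite mem_index_iota /= => jN ->; rewrite val_tile_of //= eqxx.
Qed.

Lemma column_steps_le_energy (f : G -> R) (S : seq G) T : uniq S ->
  supported_inside S f -> \sum_(0 <= t < T) column_step_energy f t <= energy S f.
Proof.
move=> uS suppf.
(* The squared variation along rightward edges, 0 on the other pairs. *)
pose d (u v : G) : R := if ((val u).1.+1 == (val v).1) &&
  tiles_overlap N (val u) (val v) then (f u - f v) ^+ 2 else 0.
have d0 u v : 0 <= d u v by rewrite /d; case: ifP => // _; exact: sqr_ge0.
have dS u v : d u v != 0 -> u \in S /\ v \in S.
  rewrite /d; case: ifP => [uv|_]; last by rewrite eqxx.
  have uv' : adj u v by rewrite /adj /= /tile_adj /next_tile uv orbT.
  have [fu0|/suppf[uS' nS] _] := eqVneq (f u) 0; last by split; last exact: nS.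
  rewrite fu0 sub0r sqrrN sqrf_eq0 => /suppf[vS nS]; split=> //; apply: nS.
  by rewrite adj_sym.
pose A u := \sum_(v <- S) d u v.
have A0 u : 0 <= A u by exact: sumr_ge0.
apply: (@le_trans _ _ (\sum_(u <- S) A u)); last first.
  apply: ler_sum => u _; rewrite [leRHS]big_mkcond; apply: ler_sum => v _.
  rewrite /d; case: ifP => [uv|_]; last by case: ifP => // _; exact: sqr_ge0.
  by rewrite /adj /= /tile_adj /next_tile uv orbT.
apply: (@le_trans _ _ (\sum_(0 <= t < T) \sum_(u <- S | (val u).1 == t) A u)).
  apply: ler_sum => t _.
  apply: (@le_trans _ _ (\sum_(0 <= j < N t) A (tile_of (t, j)))); last first.
    apply: ler_sum_column => // u; apply: contraNT => uNS.
    rewrite /A big1 // => v _; apply/eqP; apply: contraNT uNS.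
    by move=> /dS[].
  apply: ler_sum_nat => j /andP[_ jN].
  apply: (@le_trans _ _ (\sum_(v <- S | (val v).1 == t.+1) d (tile_of (t, j)) v)).
    apply: le_trans (ler_sum_column _ uS (d0 (tile_of (t, j))) _); last first.
      by move=> v /dS[].
    rewrite big_mkcond; apply: ler_sum_nat => i /andP[_ iN].
    by rewrite /d !val_tile_of //= eqxx.
  by rewrite /A [leRHS](bigID (fun v : G => (val v).1 == t.+1)) /= lerDl sumr_ge0.
rewrite (eq_bigr _ (fun t _ => big_mkcond _ _)) exchange_big /=.
apply: ler_sum => u _; rewrite -big_mkcond.
have [uT|uT] := ltnP (val u).1 T.
  rewrite (big_rem (val u).1) ?mem_index_iota //= eqxx.
  rewrite big_seq_cond big1 ?addr0 // => t /andP[].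
  by rewrite rem_filter ?iota_uniq // mem_filter /= eq_sym => /andP[/negPf ->].
rewrite big_nat_cond big1 // => t /andP[/andP[_ tT]].
by case: eqP => // e; move: uT; rewrite e leqNgt tT.
Qed.


(** The average over column 0 is the value at the root, and the average over a
    column beyond the support vanishes; the sum of the steps between the two is
    controlled by the energy. *)
Lemma column_graph_energy_bound (E : R) :
  (forall T, \sum_(0 <= t < T) (N t)%:R^-1 <= E) ->
  point_energy_bound R (root : G).
Proof.
move=> bndE; exists E => f S uS suppf.
pose T := (\max_(u <- S) (val u).1).+1.
have aT : column_average f T = 0.
  rewrite /column_average big_nat_cond big1 ?mul0r // => j /andP[/andP[_ jN] _].
  apply/eqP; apply: contraTT jN => /suppf[jS _]; apply/negP => jN.
  have := @leq_bigmax_seq _ S predT (fun u : G => (val u).1) _ jS isT.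
  by rewrite val_tile_of //= /T ltnn.
have a0 : column_average f 0 = f root.
  rewrite /column_average N_0 big_nat1 divr1; congr f.
  by apply: val_inj; rewrite val_tile_of //= N_0.
have := @telescoping_energy _ T (fun t => (N t)%:R^-1) (column_average f)
  (column_step_energy f).
rewrite aT a0 subr0 => h; apply: le_trans (h _ _) _.
- by move=> t; rewrite invr_gt0 ltr0n.
- exact: column_average_step.
have e0 : 0 <= \sum_(0 <= t < T) (N t)%:R^-1 :> R.
  by apply: sumr_ge0 => t _; rewrite invr_ge0.
apply: le_trans (ler_wpM2l e0 (column_steps_le_energy T uS suppf)) _.
by apply: ler_wpM2r (bndE T); exact: energy_ge0.
Qed.

Lemma column_graph_transient (E : R) :
  (forall T, \sum_(0 <= t < T) (N t)%:R^-1 <= E) -> transient R G.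
Proof.
move=> bndE; exact: (transient_of_point_energy_bound
  column_graph_locally_finite column_graph_no_isolated
  (column_graph_energy_bound bndE)).
Qed.

End ColumnEnergy.

(** * A self-similar sequence of column sizes *)

Local Open Scope nat_scope.

Definition digit_weight (m e : nat) : nat := if e == 1 then m else 1.

(** The factor of index [i] stems from the digit of weight [b ^ i] of [t], and
    the condition [b ^ i.+1 <= t] excludes the leading digit. The leading digit
    has to be left out for [tiles] to be self-similar from column 1 on while the
    columns [t < b] have a single tile. *)
Definition tiles (b m t : nat) : nat :=
  \prod_(i < t)
    (if b ^ i.+1 <= t then b * digit_weight m (t %/ b ^ i %% b) else 1).

Lemma tiles_small b m t : t < b -> tiles b m t = 1.
Proof.
move=> tb; rewrite /tiles big1 // => i _; rewrite leqNgt.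
by rewrite (leq_trans tb) // expnS leq_pmulr // expn_gt0 (leq_trans _ tb).
Qed.

Lemma tiles_0 b m : 2 < b -> tiles b m 0 = 1.
Proof. by move=> b3; rewrite tiles_small // (leq_trans _ b3). Qed.

Lemma tiles_rec b m t : 1 < b -> b <= t ->
  tiles b m t = b * digit_weight m (t %% b) * tiles b m (t %/ b).
Proof.
move=> b1 bt; have b0 : 0 < b by exact: ltnW.
case: t bt => [|t bt]; first by rewrite leqNgt b0.
rewrite /tiles big_ord_recl expn0 divn1 expn1 bt; congr (_ * _).
have le_quo : t.+1 %/ b <= t by rewrite -ltnS ltn_Pdiv.
rewrite (big_ord_widen t (fun i => if b ^ i.+1 <= t.+1 %/ b then
   b * digit_weight m (t.+1 %/ b %/ b ^ i %% b) else 1)) //.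
rewrite [RHS]big_mkcond /=; apply: eq_bigr => i _.
rewrite /bump /= add1n (leq_divRL (b ^ i.+1)) // -expnSr -divnMA -expnS.
case: ifPn => le_i; last by rewrite if_same.
case: ltnP => // le_ti; exfalso.
move: le_i; rewrite expnSr -leq_divRL // => le_i.
by have := leq_trans (leq_trans (ltn_expl i.+1 b1) le_i) le_ti; lia.
Qed.

Section Tiles.
Variables b m : nat.
Hypotheses (b3 : 2 < b) (m0 : 0 < m).
Let b1 : 1 < b := ltnW b3.
Let b0 : 0 < b := ltnW b1.

Lemma digit_weight_gt0 e : 0 < digit_weight m e.
Proof. by rewrite /digit_weight; case: ifP. Qed.

Lemma tilesMD s e : 0 < s -> e < b ->
  tiles b m (s * b + e) = b * digit_weight m e * tiles b m s.
Proof.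
move=> s0 eb; rewrite tiles_rec // 1?(leq_trans _ (leq_addr _ _)) ?leq_pmull //.
by rewrite modnMDl modn_small // divnMDl // divn_small // addn0.
Qed.

Lemma tiles_gt0 t : 0 < tiles b m t.
Proof.
by apply: prodn_gt0 => i; case: ifP; rewrite // muln_gt0 b0 digit_weight_gt0.
Qed.

(** Adding 1 to [t] increments one digit and turns the trailing digits [b.-1]
    into 0; these two digits have weight 1, so at most one factor [m] appears or
    disappears, and at most one factor [b] when the number of digits grows. *)
Lemma tiles_ratio t :
  tiles b m t.+1 <= b * m * tiles b m t /\ tiles b m t <= b * m * tiles b m t.+1.
Proof.
elim/ltn_ind: t => t IH.
have [tb|tb] := ltnP t b.
  rewrite (tiles_small _ tb) muln1 muln_gt0 muln_gt0 b0 m0 tiles_gt0; split=> //.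
  have [tb1|tb1] := ltnP t.+1 b; first by rewrite tiles_small // muln_gt0 b0.
  have -> : t.+1 = 1 * b + 0 by rewrite mul1n addn0; apply/eqP; rewrite eqn_leq tb.
  by rewrite tilesMD // tiles_small // muln1 leq_mul.
have s0 : 0 < t %/ b by rewrite divn_gt0.
have eb : t %% b < b by rewrite ltn_mod.
move: (IH _ (ltn_Pdiv b1 (leq_trans b0 tb))) s0 eb (divn_eq t b) => {IH tb}.
move: (t %/ b) (t %% b) => s e [IH1 IH2] s0 eb -> {t}.
have [eb1|eb1] := ltnP e.+1 b.
  have bnd i j : b * digit_weight m i * tiles b m s <=
      b * m * (b * digit_weight m j * tiles b m s).
    rewrite -!mulnA leq_pmul2l // leq_mul //; first by rewrite /digit_weight; case: ifP.
    by rewrite mulnA leq_pmull // muln_gt0 b0 digit_weight_gt0.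
  by rewrite -addnS !tilesMD.
have -> : (s * b + e).+1 = s.+1 * b + 0.
  by rewrite mulSn -addnS addn0 addnC; congr (_ + _); lia.
rewrite !tilesMD // /digit_weight.
have -> : (e == 1) = false by apply/eqP; lia.
by rewrite /= !muln1 !(mulnCA _ b) !(leq_pmul2l b0).
Qed.

(** The number of tiles into which one tile is cut when the scale is refined
    by [b]. *)
Definition volume_factor := b * (b.-1 + m).

Lemma sum_digit_weight (V : nmodType) (g : nat -> V) :
  (\sum_(0 <= e < b) g (digit_weight m e) = g m + g 1 *+ b.-1)%R.
Proof.
have -> : b.-1 = (b - 2).+1 by lia.
rewrite big_ltn // big_ltn // mulrS addrCA; congr (_ + (_ + _))%R.
rewrite -sumr_const_nat; apply: eq_big_nat => e /andP[e2 _].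
by rewrite /digit_weight gtn_eqF.
Qed.

Lemma sum_tiles_digit s : 0 < s ->
  \sum_(0 <= e < b) tiles b m (s * b + e) = volume_factor * tiles b m s.
Proof.
move=> s0; rewrite (eq_big_nat _ _
  (F2 := fun e => b * tiles b m s * digit_weight m e)); last first.
  by move=> e /andP[_ eb]; rewrite tilesMD // mulnAC.
rewrite -big_distrr /= (sum_digit_weight id) /volume_factor.
have -> k : (1%N *+ k)%R = k by elim: k => // k IH; rewrite mulrS IH.
by rewrite mulnAC addrC.
Qed.

Lemma sum_tiles_digit_le s :
  \sum_(0 <= e < b) tiles b m (s * b + e) <= volume_factor * tiles b m s.
Proof.
case: s => [|s]; last by rewrite sum_tiles_digit.
rewrite (eq_big_nat _ _ (F2 := fun=> 1)) => [|e /andP[_ eb]]; last first.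
  by rewrite tiles_small.
by rewrite sum_nat_const_nat subn0 tiles_small // /volume_factor muln1 muln1; nia.
Qed.

Lemma sum_block n s (F : nat -> nat) :
  \sum_(0 <= e < b ^ n.+1) F (s * b ^ n.+1 + e) =
  \sum_(0 <= e < b ^ n) \sum_(0 <= i < b) F ((s * b ^ n + e) * b + i).
Proof.
rewrite expnSr big_nat_mul; apply: eq_bigr => e _.
by rewrite big_nat_shift; apply: eq_bigr => i _; congr F; ring.
Qed.

Lemma sum_tiles_block n s : 0 < s ->
  \sum_(0 <= e < b ^ n) tiles b m (s * b ^ n + e) =
  volume_factor ^ n * tiles b m s.
Proof.
move=> s0; elim: n => [|n IH]; first by rewrite big_nat1 muln1 addn0 mul1n.
rewrite sum_block expnS -mulnA -IH big_distrr /=; apply: eq_big_nat => e _.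
by rewrite sum_tiles_digit // addn_gt0 muln_gt0 s0 expn_gt0 b0.
Qed.

(** Equality fails for [s = 0 < n]: the first nonzero digit of [e] then leads and
    contributes no factor. *)
Lemma sum_tiles_block_le n s :
  \sum_(0 <= e < b ^ n) tiles b m (s * b ^ n + e) <=
  volume_factor ^ n * tiles b m s.
Proof.
elim: n => [|n IH]; first by rewrite big_nat1 muln1 addn0 mul1n.
rewrite sum_block expnS -mulnA; apply: leq_trans (leq_mul (leqnn _) IH).
by rewrite big_distrr /=; apply: leq_sum => e _; exact: sum_tiles_digit_le.
Qed.

(** The tiles of column [s] are cut into whole tiles of the finer columns, and
    into at least [b ^ n] of them in each. *)
Lemma dvdn_tiles_block n s e : 0 < s -> e < b ^ n ->
  tiles b m s * b ^ n %| tiles b m (s * b ^ n + e).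
Proof.
move=> s0; elim: n e => [|n IH] e.
  by rewrite ltnS leqn0 => /eqP ->; rewrite muln1 addn0 muln1.
rewrite expnSr => eb; 
have -> : s * (b ^ n * b) + e = (s * b ^ n + e %/ b) * b + e %% b.
  by rewrite {1}(divn_eq e b); ring.
rewrite tilesMD ?ltn_mod ?addn_gt0 ?muln_gt0 ?s0 ?expn_gt0 ?b0 //.
rewrite mulnA mulnC -mulnA; apply: dvdn_mul => //.
by apply: dvdn_mull; apply: IH; rewrite ltn_divLR.
Qed.

Lemma tiles_block0 n s : 0 < s -> tiles b m (s * b ^ n) = tiles b m s * b ^ n.
Proof.
move=> s0; elim: n => [|n IH]; first by rewrite !muln1.
rewrite expnSr mulnA -[s * _ * b]addn0 tilesMD // ?muln_gt0 ?s0 ?expn_gt0 ?b0 //.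
by rewrite IH /digit_weight /= muln1 mulnC mulnA.
Qed.

Lemma tiles_block_ge n s e : 0 < s -> e < b ^ n ->
  tiles b m s * b ^ n <= tiles b m (s * b ^ n + e).
Proof. by move=> s0 en; rewrite dvdn_leq ?tiles_gt0 // dvdn_tiles_block. Qed.

(** With [Z T] the sum up to [T], cutting off the last digit gives
    [Z (b * T) = b + rho * (Z T - 1)] where [rho = (b - 1 + 1 / m) / b < 1]; the
    bound is the fixed point of [z |-> b + rho * z]. *)
Lemma sum_tiles_inv (R : realFieldType) T : 1 < m ->
  (\sum_(0 <= t < T) ((tiles b m t)%:R)^-1 <=
   b%:R / (1 - (b.-1%:R + m%:R^-1) / b%:R) :> R)%R.
Proof.
move=> m1; set rho := ((b.-1%:R + m%:R^-1) / b%:R)%R; set E := (_ / _)%R.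
have bR : (0 < b%:R :> R)%R by rewrite ltr0n.
have rho0 : (0 <= rho)%R by rewrite divr_ge0 // addr_ge0 // invr_ge0.
have rho1 : (rho < 1)%R.
  rewrite ltr_pdivrMr // mul1r -[b in ltRHS](prednK b0) -natr1 ltrD2l.
  by rewrite invf_lt1 ?ltr1n // ltr0n.
(* [E] is the fixed point of the recursion on scales. *)
have EE : (E = b%:R + rho * E)%R by rewrite /E; field; rewrite subr_eq0 gt_eqF.
have E0 : (0 <= E)%R by rewrite divr_ge0 // subr_ge0 ltW.
suff bnd n : (\sum_(0 <= t < b ^ n) ((tiles b m t)%:R)^-1 <= E :> R)%R.
  apply: le_trans (bnd T); rewrite [leRHS](big_cat_nat _ (n := T)) //=.
    by rewrite lerDl sumr_ge0 // => i _; rewrite invr_ge0.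
  by rewrite ltnW // ltn_expl.
elim: n => [|n IH].
  rewrite big_nat1 tiles_small // invr1 EE -[leLHS]addr0 lerD ?(mulr_ge0 rho0 E0) //.
  by rewrite ler1n.
rewrite expnSr big_nat_mul big_ltn ?expn_gt0 ?b0 // EE lerD //.
  rewrite mul0n mul1n (eq_big_nat _ _ (F2 := fun=> 1%R)) => [|e /andP[_ eb]].
    by rewrite sumr_const_nat subn0.
  by rewrite tiles_small // invr1.
apply: le_trans (ler_wpM2l rho0 IH).
rewrite mulr_sumr [leRHS]big_ltn ?expn_gt0 ?b0 // -[leLHS]add0r lerD //.
  by rewrite mulr_ge0 // invr_ge0.
apply: ler_sum_nat => s /andP[s0 _].
rewrite big_nat_shift (eq_big_nat _ _ (F2 := fun e =>
  ((digit_weight m e)%:R^-1 / b%:R / (tiles b m s)%:R : R)%R)).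
  rewrite (sum_digit_weight (fun w => (w%:R^-1 / b%:R / (tiles b m s)%:R : R)%R)).
  by rewrite le_eqVlt invr1 /rho; apply/orP; left; apply/eqP; ring.
move=> e /andP[_ eb]; rewrite tilesMD // !natrM !invfM.
by ring.
Qed.

End Tiles.

(** * How fast walks climb *)

Lemma size_le_diameter (s : seq nat) D : uniq s ->
  (forall i j, i \in s -> j \in s -> i <= j + D) -> size s <= D.+1.
Proof.
case: s => // x s us diam.
have ex : exists i, i \in x :: s by exists x; rewrite mem_head.
have [j0 j0s j0min] := ex_minnP ex.
rewrite -(size_iota j0 D.+1); apply: uniq_leq_size => // i si.
by rewrite mem_iota j0min //= addnS ltnS diam.
Qed.

Section Drift.
Variables (R : realFieldType) (N : nat -> nat).
Hypothesis N_gt0 : forall t, 0 < N t.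

Lemma tile_adj_column (u v : tile N) : tile_adj u v -> (val u).1 <= (val v).1.+1.
Proof.
rewrite /tile_adj /next_tile.
case/orP => /orP[] /andP[/eqP e _]; rewrite ?e ?leqnSn // -e //.
by apply: leq_trans (leqnSn _) (leqnSn _).
Qed.

Lemma column_drift (u : tile N) (p : seq (tile N)) : path (@tile_adj N) u p ->
  forall x, x \in u :: p ->
    (val x).1 <= (val u).1 + size p /\ (val u).1 <= (val x).1 + size p.
Proof.
elim: p u => [|v p IH] u /=.
  by move=> _ x; rewrite inE => /eqP ->; rewrite addn0.
move=> /andP[uv vp] x; rewrite inE => /orP[/eqP ->|/(IH _ vp)[xv vx]].
  by split; rewrite leq_addr.
split; [apply: leq_trans xv _|
  rewrite addnS -addSn; apply: leq_trans (_ : (val v).1.+1 <= _)].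
- by rewrite addnS -addSn leq_add2r tile_adj_column // tile_adj_sym.
- exact: tile_adj_column.
- by rewrite addSn ltnS.
Qed.

Definition height (u : tile N) : R := ((val u).2%:R / (N (val u).1)%:R)%R.

(** Adjacent tiles have a height in common, and the bottoms differ by at most
    the larger of the two thicknesses. *)
Lemma height_step (u v : tile N) (eta : R) : next_tile N (val u) (val v) ->
  ((N (val u).1)%:R^-1 <= eta)%R -> ((N (val v).1)%:R^-1 <= eta)%R ->
  (`|height v - height u| <= eta)%R.
Proof.
have Npos (w : tile N) : (0 < (N (val w).1)%:R :> R)%R by rewrite ltr0n.
rewrite /height => uv hu hv; rewrite ler_norml.
case/orP: uv => /andP[/eqP e].
  rewrite -e => /eqP <-; rewrite -mulrBl -natr1 addrAC subrr add0r mul1r hu andbT.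
  rewrite (le_trans _ (ltW _) (y := 0%R)) ?invr_gt0 // oppr_le0.
  by rewrite (le_trans _ hu) // invr_ge0 ltW.
rewrite /tiles_overlap -!(ltr_nat R) !natrM -!natr1 => /andP[h1 h2].
move: h1 h2 hu hv (Npos u) (Npos v).
move: (N _)%:R%R (N _)%:R%R ((val u).2%:R)%R ((val v).2%:R)%R => n n' j i.
move=> h1 h2 hu hv n0 n0'.
have [j1 i1] : (j / n < i / n' + n'^-1 /\ i / n' < j / n + n^-1)%R.
  split; rewrite -[X in (_ + X)%R]mul1r -mulrDl ltr_pdivrMr // mulrAC.
    by rewrite ltr_pdivlMr.
  by rewrite ltr_pdivlMr.
by apply/andP; split; lra.
Qed.

Lemma height_drift (u : tile N) p (eta : R) : path (@tile_adj N) u p ->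
  (forall x, x \in u :: p -> ((N (val x).1)%:R^-1 <= eta)%R) ->
  (`|height (last u p) - height u| <= (size p)%:R * eta)%R.
Proof.
elim: p u => [|v p IH] u /=; first by rewrite subrr normr0 mul0r.
move=> /andP[uv vp] bnd.
have bu : ((N (val u).1)%:R^-1 <= eta)%R by apply: bnd; rewrite mem_head.
have bv : ((N (val v).1)%:R^-1 <= eta)%R by apply: bnd; rewrite !inE eqxx orbT.
have huv : (`|height v - height u| <= eta)%R.
  by case/orP: uv => uv; [|rewrite distrC]; exact: height_step.
have hp : (`|height (last v p) - height v| <= (size p)%:R * eta)%R.
  by apply: IH => // x xp; apply: bnd; rewrite inE xp orbT.
have -> : (height (last v p) - height u =
  (height (last v p) - height v) + (height v - height u))%R by rewrite subrKA.
apply: le_trans (ler_normD _ _) _.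
by rewrite -natr1 mulrDl mul1r lerD.
Qed.

End Drift.

(** * Volume of balls *)

Section Growth.
Variables b m : nat.
Hypotheses (b3 : 2 < b) (m0 : 0 < m).
Let N := tiles b m.
Let N_gt0 : forall t, 0 < N t := tiles_gt0 b3 m0.
Let N_0 : N 0 = 1 := tiles_0 m b3.
Let G := column_graph N_gt0 N_0.
Let M := volume_factor b m.
Let K := b * m.
Let b0 : 0 < b := ltnW (ltnW b3).

(** The supertile [(s, k)] of scale [n] is the union of the tiles that refine
    the [k]-th tile of column [s] when the scale is refined by [b ^ n]. *)
Definition in_supertile n s k (u : G) : bool :=
  ((val u).1 %/ b ^ n == s) && ((val u).2 * N s %/ N (val u).1 == k).

(** The horizontal walk at a given height stays inside the supertile, and its
    leftmost column has exactly [b ^ n] tiles there. *)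
Lemma supertile_to_left n s k (u : G) : 0 < s -> in_supertile n s k u ->
  exists2 u' : G, gdist u u' <= b ^ n &
    (val u').1 = s * b ^ n /\ k * b ^ n <= (val u').2 < k.+1 * b ^ n.
Proof.
move=> s0 /andP[/eqP us /eqP uk].
set t := (val u).1 in us uk *; set j := (val u).2 in uk *.
have jt : j < N t by exact: (valP u).
have NT : N (s * b ^ n) = N s * b ^ n by exact: tiles_block0.
pose j' := j * N (s * b ^ n) %/ N t.
have j'T : (s * b ^ n, j').2 < N (s * b ^ n, j').1.
  exact: (height_in_column N_gt0).
exists (exist _ (s * b ^ n, j') j'T : tile N) => /=.
  rewrite gdist_sym; apply: leq_trans (gdist_le (G := G) _) _.
    apply: (@horizontal_walk N N_gt0 _ u j (N t) (s * b ^ n) (t - s * b ^ n)).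
    - exact: jt.
    - by [].
    - rewrite subnKC; first by exact: val_tileE.
      by rewrite -us leq_trunc_div.
  by rewrite leq_subLR -us addnC; apply: ltnW; rewrite -mulSn ltn_ceil // expn_gt0 b0.
split=> //; rewrite /j' NT mulnA -uk; apply/andP; split.
  by rewrite leq_divRL // mulnAC leq_mul2r leq_trunc_div orbT.
by rewrite ltn_divLR // [ltnRHS]mulnAC ltn_mul2r expn_gt0 b0 /= ltn_ceil.
Qed.

Lemma supertile_diameter n s k (u v : G) : 0 < s ->
  in_supertile n s k u -> in_supertile n s k v -> gdist u v <= 3 * b ^ n.
Proof.
move=> s0 /(supertile_to_left s0)[u' du [u1 /andP[u2 u3]]].
move=> /(supertile_to_left s0)[v' dv [v1 /andP[v2 v3]]].
have vert (x y : G) : (val x).1 = (val y).1 -> (val x).2 <= (val y).2 ->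
    gdist x y <= (val y).2 - (val x).2.
  move=> e le; apply: (gdist_le (G := G)).
  apply: (@vertical_walk N _ _ (val x).1 (val x).2); first by case: (val x).
  by rewrite subnKC // e; case: (val y).
have duv : gdist u' v' <= b ^ n.
  have e : (val u').1 = (val v').1 by rewrite u1 v1.
  have [le|/ltnW le] := leqP (val u').2 (val v').2; last rewrite gdist_sym.
    by apply: leq_trans (vert _ _ e le) _; rewrite leq_subLR; rewrite mulSn in v3; lia.
  apply: leq_trans (vert _ _ (esym e) le) _; rewrite leq_subLR.
  by rewrite mulSn in u3; lia.
apply: leq_trans (gdist_triangle u u' v) _.
rewrite -[3]/(1 + 2) mulnDl mul1n leq_add //.
apply: leq_trans (gdist_triangle u' v' v) _.
by rewrite mul2n -addnn leq_add // gdist_sym.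
Qed.

(** Column [s * b ^ n + e] meets the supertile in [N (s * b ^ n + e) %/ N s]
    consecutive tiles, the quotient being exact. *)
Definition supertile_seq n s k : seq G :=
  [seq tile_of N_0 (s * b ^ n + e, k * (N (s * b ^ n + e) %/ N s) + i) |
     e <- iota 0 (b ^ n), i <- iota 0 (N (s * b ^ n + e) %/ N s)].

Lemma block_quotient n s e : 0 < s -> e < b ^ n ->
  N (s * b ^ n + e) = N (s * b ^ n + e) %/ N s * N s.
Proof.
move=> s0 en; rewrite divnK // (dvdn_trans _ (dvdn_tiles_block _ b3 s0 en)) //.
exact: dvdn_mulr.
Qed.

Lemma supertile_bound n s k e i : 0 < s -> k < N s -> e < b ^ n ->
  i < N (s * b ^ n + e) %/ N s ->
  k * (N (s * b ^ n + e) %/ N s) + i < N (s * b ^ n + e).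
Proof.
move=> s0 ks en iW; rewrite [ltnRHS](block_quotient s0 en) [ltnRHS]mulnC.
apply: (@leq_trans (k.+1 * (N (s * b ^ n + e) %/ N s))); last first.
  by rewrite leq_mul2r ks orbT.
by rewrite mulSn addnC ltn_add2r.
Qed.

Lemma mem_supertile_seq n s k u : 0 < s -> k < N s ->
  u \in supertile_seq n s k -> in_supertile n s k u.
Proof.
move=> s0 ks /allpairsPdep[e [i [/[!mem_iota]/= en iW ->]]].
have h := supertile_bound s0 ks en iW.
rewrite /in_supertile val_tile_of //= divnMDl ?expn_gt0 ?b0 //.
rewrite divn_small // addn0 eqxx /=.
have W0 : 0 < N (s * b ^ n + e) %/ N s by apply: leq_ltn_trans iW.
rewrite {2}(block_quotient s0 en) divnMr //.
by rewrite divnMDl // divn_small // addn0.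
Qed.

Lemma uniq_supertile_seq n s k : 0 < s -> k < N s -> uniq (supertile_seq n s k).
Proof.
move=> s0 ks; apply: allpairs_uniq_dep; rewrite ?iota_uniq //.
  by move=> e _; exact: iota_uniq.
move=> [e i] [e' i'] /allpairsPdep[f [j [/[!mem_iota]/= fn jW [? ?]]]].
move=> /allpairsPdep[f' [j' [/[!mem_iota]/= fn' jW' [? ?]]]]; subst e i e' i'.
move=> /(congr1 val); rewrite !val_tile_of /= ?supertile_bound //.
by move=> -[/addnI ff]; subst f' => /addnI ->.
Qed.

Lemma size_supertile_seq n s k : 0 < s -> size (supertile_seq n s k) = M ^ n.
Proof.
move=> s0; rewrite size_allpairs_dep sumnE big_map -{1}[b ^ n]subn0.
apply/eqP; rewrite -(eqn_pmul2r (N_gt0 s)) -(sum_tiles_block b3 _ _ s0) //.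
rewrite big_distrl /=; apply/eqP; apply: eq_big_nat => e /andP[_ en].
by rewrite size_iota -block_quotient.
Qed.

Lemma column_reach (v : G) t : (val v).1 <= t ->
  exists2 u : G, (val u).1 = t & gdist u v <= t - (val v).1.
Proof.
move=> vt; have h := height_in_column N_gt0 t (valP v).
exists (exist _ (t, _) h : tile N) => //; rewrite gdist_sym; apply: (gdist_le (G := G)).
apply: (horizontal_walk N_gt0 (valP v) (val_tileE N_gt0 v)).
by rewrite subnKC.
Qed.

(** At most [b ^ n] steps to the right reach column [b ^ n] or a later one, hence
    a supertile of scale [n], all of which is within [3 * b ^ n]. *)
Lemma ball_lower n (v : G) : exists s : seq G,
  [/\ uniq s, size s = M ^ n & forall u, u \in s -> gdist u v <= 4 * b ^ n].
Proof.
have [v' v'1 dv] : exists2 v' : G, b ^ n <= (val v').1 & gdist v' v <= b ^ n.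
  have [le|/ltnW le] := leqP (b ^ n) (val v).1.
    by exists v => //; apply: leq_trans (gdist_le (G := G) (walk0 _ v)) _.
  have [u u1 du] := column_reach le; exists u; first by rewrite u1.
  by rewrite (leq_trans du) // leq_subr.
have bn0 : 0 < b ^ n by rewrite expn_gt0 b0.
pose s := (val v').1 %/ b ^ n; pose k := (val v').2 * N s %/ N (val v').1.
have s0 : 0 < s by rewrite divn_gt0.
have ks : k < N s by exact: (height_in_column N_gt0 s (valP v')).
exists (supertile_seq n s k); split.
- exact: uniq_supertile_seq.
- exact: size_supertile_seq.
move=> u /(mem_supertile_seq s0 ks) us.
apply: leq_trans (gdist_triangle u v' v) _; rewrite -[4]/(3 + 1) mulnDl mul1n.
by rewrite leq_add // (supertile_diameter s0 us) // /in_supertile !eqxx.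
Qed.


Lemma tiles_near s s' : s <= s'.+1 -> s' <= s.+1 -> N s <= K * N s'.
Proof.
move=> h1 h2; have K0 : 0 < K by rewrite muln_gt0 b0.
have [e|[e|e]] : s = s' \/ (s = s'.+1 \/ s' = s.+1) by lia.
- by rewrite e leq_pmull.
- by rewrite e; have [] := tiles_ratio b3 m0 s'.
- by rewrite e; have [] := tiles_ratio b3 m0 s.
Qed.

Lemma sum_three_blocks n s (F : nat -> nat) :
  \sum_(0 <= x < 3 * b ^ n) F (s * b ^ n + x) =
  \sum_(0 <= a < 3) \sum_(0 <= e < b ^ n) F ((s + a) * b ^ n + e).
Proof.
rewrite big_nat_mul; apply: eq_bigr => a _; rewrite big_nat_shift.
by apply: eq_bigr => e _; rewrite mulnDl addnA.
Qed.

Lemma leq_base_volume n : b ^ n <= M ^ n.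
Proof.
case: n => // n; rewrite leq_exp2r // /M /volume_factor leq_pmulr //.
by rewrite addn_gt0 m0 orbT.
Qed.

Lemma ball_columns n (u v : G) : gdist u v < b ^ n ->
  (val u).1 < (val v).1 + b ^ n /\ (val v).1 < (val u).1 + b ^ n.
Proof.
rewrite gdist_sym => duv; have [p [vp pu ps]] := walk_gdist v u.
have [] := column_drift vp (mem_last v p); rewrite pu ps => h1 h2; split.
  by apply: leq_ltn_trans h1 _; rewrite ltn_add2l.
by apply: leq_ltn_trans h2 _; rewrite ltn_add2l.
Qed.

(** The ball lies in the first three blocks, which refine the columns 0, 1 and
    2, of one tile each. *)
Lemma ball_upper_near_root n (v : G) : (val v).1 < 2 * b ^ n ->
  exists l : seq (nat * nat), size l <= 3 * M ^ n /\
    forall u : G, gdist u v < b ^ n -> val u \in l.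
Proof.
move=> vn; exists [seq (r, j) | r <- iota 0 (3 * b ^ n), j <- iota 0 (N r)]; split.
  rewrite size_allpairs_dep sumnE big_map -{1}[3 * b ^ n]subn0.
  rewrite (eq_bigr N) => [|r _]; last by rewrite size_iota.
  rewrite (sum_three_blocks n 0 N).
  apply: (@leq_trans (\sum_(0 <= a < 3) M ^ n)); last by rewrite sum_nat_const_nat.
  rewrite big_nat [leqRHS]big_nat; apply: leq_sum => a /andP[_ a3].
  apply: leq_trans (sum_tiles_block_le b3 m0 n (0 + a)) _.
  by rewrite tiles_small ?muln1 // (leq_trans _ b3).
move=> u /ball_columns[h _]; apply/allpairsPdep; exists (val u).1, (val u).2.
rewrite !mem_iota /= (valP u) -surjective_pairing; split=> //.
by rewrite (leq_trans h) // mulSn addnC leq_add2l ltnW.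
Qed.

Variable R : realFieldType.

(** [K / N s] is the height that a walk of [b ^ n] steps can climb when it stays
    within the blocks of [s.-1], [s] and [s.+1]. *)
Definition height_window s (y : R) r : seq nat :=
  [seq j <- iota 0 (N r) | (`|j%:R / (N r)%:R - y| <= K%:R / (N s)%:R)%R].

Lemma size_height_window s y r :
  size (height_window s y r) <= (2 * K * N r %/ N s).+1.
Proof.
apply: size_le_diameter; first by rewrite filter_uniq // iota_uniq.
move=> i j; rewrite !mem_filter => /andP[hi _] /andP[hj _].
rewrite -leq_subLR leq_divRL //.
have [le|lt] := leqP i j; first by rewrite (eqP (_ : i - j == 0)) // subn_eq0.
have NsR : (0 < (N s)%:R :> R)%R by rewrite ltr0n.
have NrR : (0 < (N r)%:R :> R)%R by rewrite ltr0n.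
have : (i%:R / (N r)%:R - j%:R / (N r)%:R <= 2 * (K%:R / (N s)%:R) :> R)%R.
  by move: hi hj; rewrite !ler_norml => /andP[? ?] /andP[? ?]; lra.
move: (N r) (N s) NsR NrR lt => c a a0 c0 lt.
rewrite -mulrBl -natrB; last exact: ltnW.
by rewrite ler_pdivrMr // mulrA mulrAC ler_pdivlMr // -!natrM ler_nat.
Qed.

Lemma sum_height_window n s s' y : s <= s'.+1 -> s' <= s.+1 ->
  \sum_(0 <= e < b ^ n) size (height_window s y (s' * b ^ n + e)) <=
  (2 * K * K + 1) * M ^ n.
Proof.
move=> ss' s's.
apply: (@leq_trans (\sum_(0 <= e < b ^ n)
    ((2 * K * N (s' * b ^ n + e)) %/ N s + 1))).
  by apply: leq_sum => e _; rewrite addn1; exact: size_height_window.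
rewrite big_split /= sum_nat_const_nat subn0 muln1 mulnDl mul1n.
rewrite leq_add ?leq_base_volume // -(leq_pmul2r (N_gt0 s)).
apply: (@leq_trans (2 * K * \sum_(0 <= e < b ^ n) N (s' * b ^ n + e))).
  by rewrite big_distrl big_distrr; apply: leq_sum => e _; rewrite leq_trunc_div.
have le_sum : \sum_(0 <= e < b ^ n) N (s' * b ^ n + e) <= M ^ n * (K * N s).
  apply: leq_trans (sum_tiles_block_le b3 m0 n s') _.
  by rewrite leq_mul2l tiles_near ?orbT.
apply: leq_trans (leq_mul (leqnn (2 * K)) le_sum) _.
by move: (M ^ n) (N s) K => x z k; rewrite leq_eqVlt; apply/orP; left; apply/eqP; ring.
Qed.

(** The ball lies in the blocks of [s.-1], [s] and [s.+1], where the tiles are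
    at most [K / (N s * b ^ n)] high: it stays in a window of heights of size
    [2 * K / N s], and the number of tiles in this window is a bounded multiple
    of [M ^ n] in each block. *)
Lemma ball_upper_far n (v : G) : 2 * b ^ n <= (val v).1 ->
  exists l : seq (nat * nat), size l <= 3 * ((2 * K * K + 1) * M ^ n) /\
    forall u : G, gdist u v < b ^ n -> val u \in l.
Proof.
move=> vn; have bn0 : 0 < b ^ n by rewrite expn_gt0 b0.
pose s := (val v).1 %/ b ^ n; have s2 : 2 <= s by rewrite leq_divRL.
pose y := height R v.
pose col x := s.-1 * b ^ n + x.
exists [seq (col x, j) | x <- iota 0 (3 * b ^ n), j <- height_window s y (col x)]; split.
  rewrite size_allpairs_dep sumnE big_map -{1}[3 * b ^ n]subn0.
  rewrite (sum_three_blocks n s.-1 (fun r => size (height_window s y r))).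
  apply: (@leq_trans (\sum_(0 <= a < 3) (2 * K * K + 1) * M ^ n)).
    rewrite big_nat [leqRHS]big_nat; apply: leq_sum => a /andP[_ a3].
    by apply: sum_height_window; lia.
  by rewrite sum_nat_const_nat.
have near r : (val v).1 < r + b ^ n -> r < (val v).1 + b ^ n ->
    s <= (r %/ b ^ n).+1 /\ r %/ b ^ n <= s.+1.
  move=> h1 h2; split.
    by rewrite -[(r %/ _).+1]add1n -(divnMDl 1 r bn0) mul1n addnC leq_div2r // ltnW.
  by rewrite -[s.+1]add1n -(divnMDl 1 _ bn0) mul1n addnC leq_div2r // ltnW.
move=> u duv; have [h1 h2] := ball_columns duv; have [n1 n2] := near _ h2 h1.
have colu : (val u).1 = col ((val u).1 - s.-1 * b ^ n).
  rewrite /col subnKC // (leq_trans _ (leq_trunc_div _ (b ^ n))) //.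
  by rewrite leq_mul2r -ltnS prednK ?n1 ?orbT // ltnW.
apply/allpairsPdep; exists ((val u).1 - s.-1 * b ^ n), (val u).2.
rewrite -colu -surjective_pairing mem_filter !mem_iota /= add0n; split=> //.
  rewrite ltn_subLR -?mulnDl; last first.
    by rewrite [leqRHS]colu leq_addr.
  apply: leq_trans (ltn_ceil (val u).1 bn0) _.
  by rewrite leq_mul2r; apply/orP; right; lia.
apply/andP; split; last exact: (valP u).
have [p [vp pu ps]] := walk_gdist v u.
(* A bound on the height of the tiles of the three blocks. *)
pose eta : R := (K%:R / ((N s)%:R * (b ^ n)%:R))%R.
have NsR : (0 < (N s)%:R :> R)%R by rewrite ltr0n.
have bnR : (0 < (b ^ n)%:R :> R)%R by rewrite ltr0n.
have bnd x : x \in v :: p -> ((N (val x).1)%:R^-1 <= eta)%R.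
  move=> /(column_drift vp); rewrite ps gdist_sym => -[x1 x2].
  have [||m1 m2] := near (val x).1.
  - by apply: leq_ltn_trans x2 _; rewrite ltn_add2l.
  - by apply: leq_ltn_trans x1 _; rewrite ltn_add2l.
  rewrite /eta -[leLHS]mul1r ler_pdivrMr ?ltr0n // mulrAC ler_pdivlMr ?mulr_gt0 //.
  rewrite mul1r -!natrM ler_nat.
  have q0 : 0 < (val x).1 %/ b ^ n by lia.
  rewrite [leqRHS](_ : _ = K * N ((val x).1 %/ b ^ n * b ^ n + (val x).1 %% b ^ n)).
    apply: leq_trans (_ : K * (N ((val x).1 %/ b ^ n) * b ^ n) <= _).
      by rewrite mulnA leq_mul2r tiles_near ?orbT.
    by rewrite leq_mul2l tiles_block_ge ?orbT // ltn_mod.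
  by rewrite -divn_eq.
have := height_drift (tiles_gt0 b3 m0) vp bnd; rewrite pu ps -/y => /le_trans; apply.
have k_le : gdist v u <= b ^ n by rewrite gdist_sym ltnW.
move: (gdist v u) k_le NsR bnR; rewrite /eta.
move: (b ^ n) (N s) K => B c k l lB c0 B0.
have -> : (k%:R / c%:R = B%:R * (k%:R / (c%:R * B%:R)) :> R)%R.
  by field; rewrite !gt_eqF.
by rewrite ler_wpM2r ?ler_nat // divr_ge0 // mulr_ge0.
Qed.

Lemma ball_upper n (v : G) :
  exists l : seq (nat * nat), size l <= 3 * (2 * K * K + 1) * M ^ n /\
    forall u : G, gdist u v < b ^ n -> val u \in l.
Proof.
have [/ball_upper_near_root[l [sl hl]]|/ball_upper_far[l [sl hl]]] :=
  ltnP (val v).1 (2 * b ^ n); exists l; split=> //; last by rewrite -mulnA.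
by apply: leq_trans sl _; rewrite leq_mul2r leq_pmulr ?orbT // addn1.
Qed.

End Growth.

(** * The exponent *)

Local Open Scope ring_scope.

(** Bounds at the radii [b ^ k] are enough: they differ by a bounded factor from
    one scale to the next. With [b ^ k <= r < b ^ k.+1] and [3 < b], the ball of
    radius [r] contains the one of radius [4 * b ^ k.-1] if [k > 0], and its
    centre in any case. *)
Lemma uniform_growth_of_scales (R : realType) (G : connected_graph) (d : R)
    (b M C : nat) :
  (3 < b)%N -> (0 < M)%N -> 0 <= d -> b%:R `^ d = M%:R :> R ->
  (forall n (v : G), exists s : seq G,
    [/\ uniq s, size s = (M ^ n)%N & forall u, u \in s -> (gdist u v <= 4 * b ^ n)%N]) ->
  (forall n (v : G), exists s : seq G,
    (size s <= C * M ^ n)%N /\ forall u : G, (gdist u v < b ^ n)%N -> u \in s) ->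
  uniform_polynomial_growth G d.
Proof.
move=> b4 M0 d0 bd lower upper.
have M0R : 0 < M%:R :> R by rewrite ltr0n.
have powE n : ((b ^ n)%:R : R) `^ d = (M ^ n)%:R.
  by rewrite !natrX -!powR_mulrn // -powRrM mulrC powRrM bd.
exists (C.+1 * M)%:R, (M%:R ^+ 2)^-1; split.
- by rewrite ltr0n muln_gt0.
- by rewrite invr_gt0 exprn_gt0.
move=> v r r1.
have r0 : 0 <= r by apply: le_trans r1.
have [k bk rk] : exists2 k, ((b ^ k)%:R <= r) & r < (b ^ k.+1)%:R.
  have t0 : (0 < Num.truncn r)%N by rewrite truncn_gt0.
  have /andP[h1 h2] := trunc_log_bounds (ltn_trans (isT : 1 < 3)%N b4) t0.
  have /andP[h3 h4] := truncn_itv r0.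
  exists (trunc_log b (Num.truncn r)); first by rewrite (le_trans _ h3) // ler_nat.
  by rewrite (lt_le_trans h4) // ler_nat.
have [s [ss hs]] := upper k.+1 v.
have ball_s : gball v r `<=` [set` s].
  by move=> u /= ur; apply: hs; rewrite -(ltr_nat R); exact: le_lt_trans ur rk.
have fin : finite_set (gball v r) by exact: sub_finite_set ball_s (finite_seq s).
split=> //; apply/andP; split.
  have rd : r `^ d <= (M ^ k.+1)%:R.
    by rewrite -powE ge0_ler_powR ?nnegrE // ltW.
  have le_card : (M ^ k.+1 <= M ^ 2 * #|` fset_set (gball v r)|)%N.
    case: k bk {rk ss hs rd} => [|k] bk.
      rewrite (leq_trans (n := M ^ 2)%N) ?leq_pexp2l // leq_pmulr // cardfs_gt0.
      apply/fset0Pn; exists v.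
      rewrite in_fset_set //; apply/mem_set; rewrite /gball /=.
      apply: le_trans (_ : 0%:R <= _); rewrite ?ler_nat //.
      exact: gdist_le (walk0 _ v).
    rewrite -add2n expnD leq_mul //.
    have [s' [us' <- hs']] := lower k v; apply: uniq_leq_size => // u us.
    rewrite in_fset_set //; apply/mem_set; rewrite /gball /=; apply: le_trans bk.
    by rewrite ler_nat (leq_trans (hs' _ us)) // expnS leq_mul.
  rewrite mulrC ler_pdivrMr ?exprn_gt0 // (le_trans rd) // -natrX -natrM ler_nat.
  by rewrite mulnC.
have rd : (M ^ k)%:R <= r `^ d.
  by rewrite -powE ge0_ler_powR ?nnegrE.
have card : (#|` fset_set (gball v r)| <= C * M ^ k.+1)%N.
  apply: leq_trans ss; apply: uniq_leq_size; first exact: fset_uniq.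
  by move=> u; rewrite in_fset_set // => /set_mem /ball_s.
apply: (@le_trans _ _ ((C.+1 * M)%:R * (M ^ k)%:R)); last by rewrite ler_wpM2l.
by rewrite -natrM ler_nat (leq_trans card) // expnS mulnA !leq_mul.
Qed.

Theorem theorem1p1 (R : realType) (d : rat) (hd : 2 < d) :
  exists G : connected_graph,
    [/\ transient R G, planar R G & uniform_polynomial_growth G (ratr d : R)].
Proof.
have [p [q [q0 qp dE]]] : exists p q : nat,
    [/\ (0 < q)%N, (2 * q < p)%N & d = p%:R / q%:R].
  have d0 : 0 < d by apply: lt_trans hd.
  have dden : `|denq d|%N%:R = (denq d)%:~R :> rat.
    by rewrite -[in RHS](gez0_abs (denq_ge0 d)).
  have dnum : `|numq d|%N%:R = (numq d)%:~R :> rat.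
    by rewrite -[in RHS](gez0_abs (_ : 0 <= numq d)) // numq_ge0 ltW.
  exists `|numq d|%N, `|denq d|%N; rewrite absz_gt0 denq_eq0 dnum dden divq_num_den.
  split=> //; rewrite -(ltr_nat rat) natrM dnum dden.
  by rewrite -ltr_pdivlMr ?divq_num_den // ltr0z denq_gt0.
pose b := (4 ^ q)%N; pose m := (4 ^ (p - q) - 4 ^ q + 1)%N.
have b4 : (3 < b)%N by exact: (leq_pexp2l (isT : 0 < 4)%N q0).
have m1 : (1 < m)%N.
  by rewrite /m addn1 ltnS subn_gt0 ltn_exp2l // ltn_subRL; lia.
have volE : volume_factor b m = (4 ^ p)%N.
  have le : (4 ^ q <= 4 ^ (p - q))%N by rewrite leq_exp2l //; lia.
  have -> : (4 ^ p = 4 ^ q * 4 ^ (p - q))%N by rewrite -expnD subnKC //; lia.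
  by rewrite /volume_factor /b /m; congr (_ * _)%N; move: b4; rewrite /b; lia.
have b3 : (2 < b)%N by exact: ltnW.
have m0 : (0 < m)%N by exact: ltnW.
exists (column_graph (tiles_gt0 b3 m0) (tiles_0 m b3)); split.
- by apply: column_graph_transient => T; exact: sum_tiles_inv.
- exact: planar_column_graph.
- apply: (@uniform_growth_of_scales _ _ _ b (4 ^ p)
    (3 * (2 * (b * m) * (b * m) + 1))) => //.
  + by rewrite expn_gt0.
  + by rewrite ler0q ltW // (lt_trans _ hd).
  + rewrite dE fmorph_div !rmorph_nat /b !natrX -!powR_mulrn // -powRrM.
    by rewrite mulrC divfK // pnatr_eq0 -lt0n.
  + by move=> n v; rewrite -volE; exact: ball_lower.
  + move=> n v; have [l [sl hl]] := ball_upper R n v.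
    exists [seq tile_of (tiles_0 m b3) x | x <- l]; split.
      by rewrite size_map -volE.
    by move=> u /hl ul; apply/mapP; exists (val u); rewrite ?tile_ofK.
Qed.
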